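(* Let $(\mathcal{M},\omega)$ be a symplectic manifold. Under the commutator bracket of vector fields, the space $\mathcal{X}_{\mathrm{S}}(\mathcal{M},\omega)$ of symplectic vector fields is a Lie algebra, and the space $\mathcal{X}_{\mathrm{H}}(\mathcal{M},\omega)$ of Hamiltonian vector fields is an ideal in it. The quotient Lie algebra $\mathcal{X}_{\mathrm{S}}(\mathcal{M},\omega)/\mathcal{X}_{\mathrm{H}}(\mathcal{M},\omega)$ is Abelian, and is linearly isomorphic to the first de Rham cohomology group $H^1_{\mathrm{dR}}(\mathcal{M})$, hence to the first Euler-Lagrange cohomology group $H_{\mathrm{EL}}(\mathcal{M},\omega)$.
   Context: For a smooth vector field $X$ on $\mathcal{M}$ put $E_X:=-i_X\omega$. $X$ is symplectic if $\mathrm{d}E_X=0$ (equivalently $\mathcal{L}_X\omega=0$), and Hamiltonian if $E_X=\mathrm{d}H$ for some smooth function $H$ on $\mathcal{M}$. An Euler-Lagrange 1-form is a 1-form of the form $E_X-\mathrm{d}H$, with $X$ a smooth vector field and $H$ a smooth function on $\mathcal{M}$. $\Omega_{\mathrm{EL}}(\mathcal{M})$ is the real linear space of all finite sums of Euler-Lagrange 1-forms, and the first Euler-Lagrange cohomology group is the quotient vector space $H_{\mathrm{EL}}(\mathcal{M},\omega):=\{\text{closed 1-forms in }\Omega_{\mathrm{EL}}(\mathcal{M})\}/\{\text{exact 1-forms in }\Omega_{\mathrm{EL}}(\mathcal{M})\}$. *)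

(* Defs.v *)
From HB Require Import structures.
From mathcomp Require Import all_boot all_order all_algebra generic_quotient.
From mathcomp Require Import ring_quotient.
From mathcomp Require Import mathcomp_extra boolp classical_sets functions.
From mathcomp Require Import cardinality reals topology normedtype derive.

Set Implicit Arguments.
Unset Strict Implicit.
Unset Printing Implicit Defensive.

Import Order.TTheory GRing.Theory Num.Theory.
Import numFieldNormedType.Exports.

Local Open Scope classical_set_scope.
Local Open Scope quotient_scope.
Local Open Scope ring_scope.

Section linear_algebra.
Variables (R : pzRingType) (V : lmodType R).

Record subspace_of (A : submodClosed V) := SubspaceOf {
  subspace_val :> V ;
  subspace_valP : subspace_val \in A }.

HB.instance Definition _ (A : submodClosed V) :=
  [isSub for @subspace_val A].
HB.instance Definition _ (A : submodClosed V) :=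
  [Choice of subspace_of A by <:].
HB.instance Definition _ (A : submodClosed V) :=
  [SubChoice_isSubLmodule of subspace_of A by <:].

Definition trace_in (A B : submodClosed V) : {pred subspace_of A} :=
  [pred u | val u \in B].
Arguments trace_in A B _ : clear implicits.

Fact trace_in_submod (A B : submodClosed V) : submod_closed (trace_in A B).
Proof.
split; first by rewrite inE rpred0.
by move=> a u v; rewrite !inE => uB vB; rewrite linearP rpredD ?rpredZ.
Qed.
HB.instance Definition _ (A B : submodClosed V) :=
  GRing.isSubmodClosed.Build R (subspace_of A) (trace_in A B)
    (trace_in_submod A B).

End linear_algebra.
Arguments trace_in {R V} A B _.

Section quotient_space.
Variables (R : pzRingType) (V : lmodType R) (I : submodClosed V).

(* [submodClosed] does not inherit from [zmodClosed]; quotients need the latter. *)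
Definition submod_zmod : {pred V} := I.
Fact submod_zmod_closed : zmod_closed submod_zmod.
Proof.
split; first exact: rpred0 I.
by move=> u v uI vI; rewrite -scaleN1r; apply: (rpredD (S := I)) => //; exact: rpredZ.
Qed.
HB.instance Definition _ :=
  GRing.isZmodClosed.Build V submod_zmod submod_zmod_closed.

Definition quot_space := Quotient.quot submod_zmod.

HB.instance Definition _ := GRing.Zmodule.on quot_space.
HB.instance Definition _ := Quotient.on quot_space.

Definition quot_scale (a : R) (x : quot_space) : quot_space :=
  \pi_quot_space (a *: repr x).

Fact pi_quot_scale (a : R) (u : V) :
  quot_scale a (\pi_quot_space u) = \pi_quot_space (a *: u).
Proof.
rewrite /quot_scale; apply/eqP.
rewrite -(Quotient.idealrBE submod_zmod) -scalerBr; apply: (@rpredZ _ _ I).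
by rewrite [_ \in _](Quotient.idealrBE submod_zmod) reprK.
Qed.

Fact pi_quotD (u v : V) :
  \pi_quot_space (u + v) = \pi_quot_space u + \pi_quot_space v.
Proof. exact: (@Quotient.pi_add V submod_zmod). Qed.

Fact quot_scaleA a b x : quot_scale a (quot_scale b x) = quot_scale (a * b) x.
Proof. by rewrite -[x]reprK (pi_quot_scale b) !pi_quot_scale scalerA. Qed.

Fact quot_scale1 : left_id 1 quot_scale.
Proof. by move=> x; rewrite -[x]reprK pi_quot_scale scale1r. Qed.

Fact quot_scaleDr : right_distributive quot_scale +%R.
Proof.
move=> a x y; rewrite -[x]reprK -[y]reprK -pi_quotD !pi_quot_scale.
by rewrite -pi_quotD scalerDr.
Qed.

Fact quot_scaleDl x : {morph quot_scale^~ x : a b / a + b}.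
Proof.
by move=> a b; rewrite -[x]reprK !pi_quot_scale scalerDl pi_quotD.
Qed.

HB.instance Definition _ := GRing.Zmodule_isLmodule.Build R quot_space
  quot_scaleA quot_scale1 quot_scaleDr quot_scaleDl.

End quotient_space.

(* The quotient vector space [A / (A `&` B)] of two subspaces of [V] *)
Definition subquotient (R : pzRingType) (V : lmodType R)
  (A B : submodClosed V) := quot_space (trace_in A B).
HB.instance Definition _ (R : pzRingType) (V : lmodType R)
  (A B : submodClosed V) := GRing.Lmodule.on (subquotient A B).

Definition subq_class (R : pzRingType) (V : lmodType R) (A B : submodClosed V)
  (u : subspace_of A) : subquotient A B := \pi_(quot_space (trace_in A B)) u.

Section lie.
Variables (R : pzRingType) (L : lmodType R) (br : L -> L -> L).

Definition lie_bracket :=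
  [/\ forall z, linear (br^~ z), forall z, linear (br z),
      forall x, br x x = 0 &
      forall x y z, br x (br y z) + br y (br z x) + br z (br x y) = 0].

Definition lie_ideal (I : submodClosed L) :=
  forall x y, y \in I -> br x y \in I.

End lie.

Section euclidean.
Variables (R : realType) (m : nat).
Implicit Types (f g : 'rV[R]_m -> R) (U : set 'rV[R]_m).

Definition basis_vec (i : 'I_m) : 'rV[R]_m := delta_mx 0 i.

Definition partial (i : 'I_m) f : 'rV[R]_m -> R :=
  fun x => 'D_(basis_vec i) f x.

Definition iter_partial (s : seq 'I_m) f : 'rV[R]_m -> R := foldr partial f s.

(* C^oo on an open set: the partial derivatives of all orders exist and are
   continuous *)
Definition smooth_on U f := forall (s : seq 'I_m) x, U x ->
  {for x, continuous (iter_partial s f)} /\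
  forall i, derivable (iter_partial s f) x (basis_vec i).

Fact iter_partial_lin U f g a s x : open U -> smooth_on U f -> smooth_on U g ->
  U x -> iter_partial s (a *: f + g) x =
         (a *: iter_partial s f + iter_partial s g) x.
Proof.
move=> oU sf sg; elim: s x => [//|i s IH] x Ux /=.
rewrite {1}/partial (@near_eq_derive _ _ _ _
  (a *: iter_partial s f + iter_partial s g)); last first.
  have nU : nbhs x U by exact: open_nbhs_nbhs.
  by apply: filterS nU => y /IH.
have [_ /(_ i) df] := sf s x Ux; have [_ /(_ i) dg] := sg s x Ux.
by rewrite deriveD ?deriveZ //; exact: derivableZ.
Qed.

Fact smooth_on_lin U f g a : open U -> smooth_on U f -> smooth_on U g ->
  smooth_on U (a *: f + g).
Proof.
move=> oU sf sg s x Ux.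
have nE : \forall y \near x, (a *: iter_partial s f + iter_partial s g) y =
                             iter_partial s (a *: f + g) y.
  have nU : nbhs x U by exact: open_nbhs_nbhs.
  by apply: filterS nU => y Uy; rewrite (iter_partial_lin _ _ oU sf sg).
have [cf df] := sf s x Ux; have [cg dg] := sg s x Ux; split.
  rewrite /prop_for /continuous_at (iter_partial_lin _ _ oU sf sg) //.
  apply: (cvg_trans (near_eq_cvg nE)).
  by apply: cvgD => //; apply: cvgZl_tmp.
move=> i; apply: (near_eq_derivable nE).
by apply: derivableD => //; exact: derivableZ.
Qed.

Fact smooth_on0 U : smooth_on U 0.
Proof.
have E s : iter_partial s (0 : 'rV[R]_m -> R) = 0.
  elim: s => [//|i s /= ->]; apply/funext => x.
  by rewrite /partial (derive_cst (0 : R)).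
move=> s x _; rewrite E; split; first exact: cst_continuous.
by move=> i; exact: (derivable_cst (0 : R)).
Qed.

End euclidean.

Record chart (R : realType) (m : nat) (T : topologicalType) := Chart {
  chart_dom : set T ;
  chart_map : T -> 'rV[R]_m ;
  chart_inv : 'rV[R]_m -> T ;
  chart_dom_open : open chart_dom ;
  chart_codom_open : open (chart_map @` chart_dom) ;
  chart_mapK : {in chart_dom, cancel chart_map chart_inv} ;
  chart_map_continuous : {in chart_dom, continuous chart_map} ;
  chart_inv_continuous : {in chart_map @` chart_dom, continuous chart_inv} }.

Definition chart_codom (R : realType) (m : nat) (T : topologicalType)
  (c : chart R m T) : set 'rV[R]_m := chart_map c @` chart_dom c.

Definition chart_coord (R : realType) (m : nat) (T : topologicalType)
  (c : chart R m T) (j : 'I_m) (p : T) : R := chart_map c p 0 j.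

(* Smooth m-manifolds: a Hausdorff second countable space with a smooth atlas,
   not required to be maximal. The preferred chart [chart_at p] is the one in
   which tangent vectors and covectors at [p] are written (see below). *)
Record smoothManifold (R : realType) (m : nat) := SmoothManifold {
  manifold_space :> topologicalType ;
  manifold_hausdorff : hausdorff_space manifold_space ;
  manifold_countable : @second_countable manifold_space ;
  chart_idx : Type ;
  charts : chart_idx -> chart R m manifold_space ;
  chart_at : manifold_space -> chart_idx ;
  mem_chart_at : forall p, chart_dom (charts (chart_at p)) p ;
  transition_smooth : forall (a b : chart_idx) (j : 'I_m),
    smooth_on (chart_map (charts a) @`
                 (chart_dom (charts a) `&` chart_dom (charts b)))
              (chart_coord (charts b) j \o chart_inv (charts a)) }.

(* The tangent space at [p] is R^m, a row vector [v] standing for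
   [\sum_i v 0 i d/dx^i], where the x^i are the coordinates of [chart_at p].
   Dually, covectors at [p] are column vectors, [v *m a] being the value of [a]
   at [v], and bilinear forms on the tangent space at [p] are matrices.
   Hence arbitrary (not necessarily smooth) vector fields, 1-forms and fields
   of bilinear forms are functions from [M] to ['rV_m], ['cV_m] and ['M_m]. *)
Section manifold.
Variables (R : realType) (m : nat) (M : smoothManifold R m).
Implicit Types (c : chart_idx M) (p : M) (f H : M -> R).
Implicit Types (X Y : M -> 'rV[R]_m) (a b : M -> 'cV[R]_m).

(* [f] may be a function that is meaningful only on the domain of [c] *)
Definition smooth_in c f :=
  smooth_on (chart_codom (charts c)) (f \o chart_inv (charts c)).

Definition smooth_fun f := forall c, smooth_in c f.

(* (df/dx^i)(p), where x^i is the i-th coordinate of the chart [c] *)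
Definition pderiv c (i : 'I_m) f p : R :=
  partial i (f \o chart_inv (charts c)) (chart_map (charts c) p).

Definition vaction X f p : R :=
  \sum_(i < m) X p 0 i * pderiv (chart_at p) i f p.

(* A vector field is smooth if its components X(x^j) are, in every chart. *)
Definition smooth_vfield X :=
  forall c (j : 'I_m), smooth_in c (vaction X (chart_coord (charts c) j)).

(* The commutator [X, Y] = XY - YX, given by its components
   [X, Y](x^j) = X(Y(x^j)) - Y(X(x^j)). *)
Definition vbracket X Y : M -> 'rV[R]_m := fun p =>
  \row_(j < m)
    (vaction X (vaction Y (chart_coord (charts (chart_at p)) j)) p -
     vaction Y (vaction X (chart_coord (charts (chart_at p)) j)) p).

(* d/dx^i for the chart [c], as a tangent vector at [p] *)
Definition coord_vec c (i : 'I_m) p : 'rV[R]_m :=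
  \row_(j < m) pderiv c i (chart_coord (charts (chart_at p)) j) p.

Definition form1_comp a c (i : 'I_m) p : R := (coord_vec c i p *m a p) 0 0.

Definition smooth_form1 a := forall c i, smooth_in c (form1_comp a c i).

Definition ext_d0 H : M -> 'cV[R]_m := fun p =>
  \col_(i < m) pderiv (chart_at p) i H p.

Definition ext_d1 a : M -> 'M[R]_m := fun p =>
  \matrix_(i < m, j < m)
    (pderiv (chart_at p) i (form1_comp a (chart_at p) j) p -
     pderiv (chart_at p) j (form1_comp a (chart_at p) i) p).

Definition closed_form1 a := smooth_form1 a /\ ext_d1 a = 0.

Definition exact_form1 a := exists2 H, smooth_fun H & a = ext_d0 H.

Definition form2_eval (w : M -> 'M[R]_m) p (u v : 'rV[R]_m) : R :=
  (u *m w p *m v^T) 0 0.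

Definition form2_comp w c (i j : 'I_m) p : R :=
  form2_eval w p (coord_vec c i p) (coord_vec c j p).

Record symplecticForm := SymplecticForm {
  sform :> M -> 'M[R]_m ;
  sform_alternating : forall p v, form2_eval sform p v v = 0 ;
  sform_smooth : forall c i j, smooth_in c (form2_comp sform c i j) ;
  (* d w = 0 *)
  sform_closed : forall p (i j k : 'I_m),
    pderiv (chart_at p) i (form2_comp sform (chart_at p) j k) p +
    pderiv (chart_at p) j (form2_comp sform (chart_at p) k i) p +
    pderiv (chart_at p) k (form2_comp sform (chart_at p) i j) p = 0 ;
  sform_nondegenerate : forall p u,
    (forall v, form2_eval sform p u v = 0) -> u = 0 }.

Lemma smooth_in_lin c f g (k : R) : smooth_in c f -> smooth_in c g ->
  smooth_in c (k *: f + g).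
Proof. exact/smooth_on_lin/chart_codom_open. Qed.

Lemma pderiv_lin f g (k : R) i p :
  smooth_in (chart_at p) f -> smooth_in (chart_at p) g ->
  pderiv (chart_at p) i (k *: f + g) p =
  k * pderiv (chart_at p) i f p + pderiv (chart_at p) i g p.
Proof.
move=> sf sg; set c := charts (chart_at p).
have cp : chart_codom c (chart_map c p) by exists p => //; exact: mem_chart_at.
exact: (iter_partial_lin k [:: i] (@chart_codom_open _ _ _ c) sf sg cp).
Qed.

Lemma pderiv0 c i p : pderiv c i 0 p = 0.
Proof. by rewrite /pderiv /partial (derive_cst (0 : R)). Qed.

Lemma vaction_lin X Y (k : R) f :
  vaction (k *: X + Y) f = k *: vaction X f + vaction Y f.
Proof.
apply/funext => p.
transitivity (k * vaction X f p + vaction Y f p); last by [].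
rewrite /vaction mulr_sumr -big_split; apply: eq_bigr => i _ /=.
by rewrite !mxE mulrDl mulrA.
Qed.

Lemma form1_comp_lin a b (k : R) c i :
  form1_comp (k *: a + b) c i = k *: form1_comp a c i + form1_comp b c i.
Proof.
apply/funext => p.
transitivity (k * form1_comp a c i p + form1_comp b c i p); last by [].
have E : (k *: a + b) p = k *: a p + b p by [].
by rewrite /form1_comp E linearP 2!mxE.
Qed.

Lemma smooth_vfield_submod : submod_closed [pred X | `[< smooth_vfield X >]].
Proof.
split; rewrite ?inE.
  move=> c j; rewrite (_ : vaction 0 _ = 0); first exact: smooth_on0.
  by apply/funext => p; apply: big1 => i _; rewrite mxE mul0r.
move=> k X Y; rewrite !inE => sX sY c j.
by rewrite vaction_lin; apply: smooth_in_lin.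
Qed.

Definition closed_forms : {pred M -> 'cV[R]_m} :=
  [pred a | `[< closed_form1 a >]].

Fact closed_forms_submod : submod_closed closed_forms.
Proof.
split; rewrite ?inE.
  have E c i : form1_comp 0 c i = 0.
    by apply/funext => p; rewrite /form1_comp mulmx0 mxE.
  split=> [c i|]; first by rewrite E; exact: smooth_on0.
  by apply/funext => p; apply/matrixP => i j; rewrite !mxE !E !pderiv0 subrr.
move=> k a b; rewrite !inE => -[sa da] [sb db].
split=> [c i|]; first by rewrite form1_comp_lin; apply: smooth_in_lin.
apply/funext => p; apply/matrixP => i j.
have /matrixP/(_ i j) := congr1 (@^~ p) da.
have /matrixP/(_ i j) := congr1 (@^~ p) db.
rewrite !mxE !form1_comp_lin !pderiv_lin //= => eb ea.
by rewrite opprD addrACA -mulrBr ea eb mulr0 addr0.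
Qed.
HB.instance Definition _ :=
  GRing.isSubmodClosed.Build R (M -> 'cV[R]_m) closed_forms closed_forms_submod.

Lemma smooth_fun_lin f g (k : R) :
  smooth_fun f -> smooth_fun g -> smooth_fun (k *: f + g).
Proof. by move=> sf sg c; apply: smooth_in_lin. Qed.

Lemma ext_d0_lin f g (k : R) : smooth_fun f -> smooth_fun g ->
  ext_d0 (k *: f + g) = k *: ext_d0 f + ext_d0 g.
Proof.
move=> sf sg; apply/funext => p; apply/matrixP => i j.
by rewrite !mxE pderiv_lin.
Qed.

Lemma ext_d0_0 : ext_d0 0 = 0.
Proof. by apply/funext => p; apply/matrixP => i j; rewrite !mxE pderiv0. Qed.

Lemma smooth_fun0 : smooth_fun 0.
Proof. by move=> c; exact: smooth_on0. Qed.

Definition exact_forms : {pred M -> 'cV[R]_m} :=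
  [pred a | `[< exact_form1 a >]].

Fact exact_forms_submod : submod_closed exact_forms.
Proof.
split; rewrite ?inE.
  by exists 0; rewrite ?ext_d0_0 //; exact: smooth_fun0.
move=> k a b; rewrite !inE => -[f sf ->] [g sg ->].
exists (k *: f + g); first exact: smooth_fun_lin.
by rewrite ext_d0_lin.
Qed.
HB.instance Definition _ :=
  GRing.isSubmodClosed.Build R (M -> 'cV[R]_m) exact_forms exact_forms_submod.

Definition deRham1 := subquotient closed_forms exact_forms.
HB.instance Definition _ := GRing.Lmodule.on deRham1.

End manifold.

Section symplectic.
Variables (R : realType) (m : nat) (M : smoothManifold R m).
Variable w : symplecticForm M.
Implicit Types (X Y : M -> 'rV[R]_m) (a b : M -> 'cV[R]_m) (H : M -> R).

(* E_X = - i_X w, i.e. the 1-form v |-> - w(X, v) *)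
Definition EL_contract X : M -> 'cV[R]_m := fun p => - (X p *m w p)^T.

Definition symplectic_fields : {pred M -> 'rV[R]_m} :=
  [pred X | `[< smooth_vfield X /\ closed_form1 (EL_contract X) >]].

Definition hamiltonian_fields : {pred M -> 'rV[R]_m} :=
  [pred X | `[< smooth_vfield X /\ exact_form1 (EL_contract X) >]].

Definition EL_form a := exists X H,
  [/\ smooth_vfield X, smooth_fun H & a = EL_contract X - ext_d0 H].

Definition EL_span : {pred M -> 'cV[R]_m} :=
  [pred a | `[< exists2 s : seq (M -> 'cV[R]_m),
                  (forall b, b \in s -> EL_form b) & a = \sum_(b <- s) b >]].

Definition EL_closed_forms : {pred M -> 'cV[R]_m} :=
  [pred a | (a \in EL_span) && (a \in @closed_forms R m M)].

Definition EL_exact_forms : {pred M -> 'cV[R]_m} :=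
  [pred a | (a \in EL_span) && (a \in @exact_forms R m M)].

Lemma EL_contract_lin X Y (k : R) :
  EL_contract (k *: X + Y) = k *: EL_contract X + EL_contract Y.
Proof.
apply/funext => p; rewrite /EL_contract mulmxDl -scalemxAl linearP opprD.
by rewrite -scalerN.
Qed.

Lemma EL_contract0 : EL_contract 0 = 0.
Proof. by apply/funext => p; rewrite /EL_contract mul0mx trmx0 oppr0. Qed.

Fact symplectic_fields_submod : submod_closed symplectic_fields.
Proof.
have [v0 vD] := smooth_vfield_submod M; have [c0 cD] := closed_forms_submod M.
split; rewrite ?inE.
  by rewrite EL_contract0; move: v0 c0; rewrite !inE.
move=> k X Y; rewrite !inE => -[sX dX] [sY dY].
rewrite EL_contract_lin; split.
  by have := vD k X Y; rewrite !inE; apply.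
by have := cD k (EL_contract X) (EL_contract Y); rewrite !inE; apply.
Qed.
HB.instance Definition _ := GRing.isSubmodClosed.Build R (M -> 'rV[R]_m)
  symplectic_fields symplectic_fields_submod.

Fact hamiltonian_fields_submod : submod_closed hamiltonian_fields.
Proof.
have [v0 vD] := smooth_vfield_submod M; have [c0 cD] := exact_forms_submod M.
split; rewrite ?inE.
  by rewrite EL_contract0; move: v0 c0; rewrite !inE.
move=> k X Y; rewrite !inE => -[sX dX] [sY dY].
rewrite EL_contract_lin; split.
  by have := vD k X Y; rewrite !inE; apply.
by have := cD k (EL_contract X) (EL_contract Y); rewrite !inE; apply.
Qed.
HB.instance Definition _ := GRing.isSubmodClosed.Build R (M -> 'rV[R]_m)
  hamiltonian_fields hamiltonian_fields_submod.

Lemma EL_formZ (k : R) a : EL_form a -> EL_form (k *: a).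
Proof.
have [v0 vD] := smooth_vfield_submod M.
move=> [X [H [sX sH ->]]]; exists (k *: X), (k *: H); split.
- by rewrite -[k *: X]addr0; move: v0 (vD k X 0); rewrite !inE => v0; apply.
- by rewrite -[k *: H]addr0; apply: smooth_fun_lin => //; exact: smooth_fun0.
- have := EL_contract_lin X 0 k; rewrite EL_contract0 !addr0 => ->.
  have := ext_d0_lin k sH (@smooth_fun0 _ _ M); rewrite ext_d0_0 !addr0 => ->.
  by rewrite scalerBr.
Qed.

Fact EL_span_submod : submod_closed EL_span.
Proof.
split; rewrite ?inE; first by exists [::]; rewrite ?big_nil.
move=> k a b; rewrite !inE => -[s hs ->] [t ht ->].
exists ([seq k *: x | x <- s] ++ t).
  move=> x; rewrite mem_cat => /orP[/mapP[y ys ->]|/ht //].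
  exact/EL_formZ/hs.
by rewrite big_cat big_map scaler_sumr.
Qed.

Fact EL_closed_forms_submod : submod_closed EL_closed_forms.
Proof.
have [v0 vD] := EL_span_submod; have [c0 cD] := closed_forms_submod M.
have memE a : (a \in EL_closed_forms) = (a \in EL_span) && (a \in @closed_forms R m M) by [].
split; first by rewrite memE v0 c0.
move=> k a b; rewrite !memE => /andP[a1 a2] /andP[b1 b2].
by rewrite (vD k a b) // (cD k a b).
Qed.
HB.instance Definition _ := GRing.isSubmodClosed.Build R (M -> 'cV[R]_m)
  EL_closed_forms EL_closed_forms_submod.

Fact EL_exact_forms_submod : submod_closed EL_exact_forms.
Proof.
have [v0 vD] := EL_span_submod; have [c0 cD] := exact_forms_submod M.
have memE a : (a \in EL_exact_forms) = (a \in EL_span) && (a \in @exact_forms R m M) by [].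
split; first by rewrite memE v0 c0.
move=> k a b; rewrite !memE => /andP[a1 a2] /andP[b1 b2].
by rewrite (vD k a b) // (cD k a b).
Qed.
HB.instance Definition _ := GRing.isSubmodClosed.Build R (M -> 'cV[R]_m)
  EL_exact_forms EL_exact_forms_submod.

Definition EL_cohomology := subquotient EL_closed_forms EL_exact_forms.
HB.instance Definition _ := GRing.Lmodule.on EL_cohomology.

End symplectic.

(* Main.v *)
(* Near each point everything is computed in one chart [c]. A vector field is
   determined by its components [X^j = X(x^j)], and the chain rule shows that
   [X f = sum_j X^j df/dx^j] in every chart around the point; with the symmetry of
   second derivatives, [[X, Y] f = X (Y f) - Y (X f)], hence the Jacobi identity.
   For [X] and [Y] symplectic, closedness of [E_X], [E_Y] and [w] gives
   [E_[X, Y] = d (w (X, Y))], so brackets of symplectic fields are Hamiltonian: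
   the Hamiltonian fields form an ideal and the quotient is Abelian. Since [w] is
   nondegenerate and its inverse matrix is smooth, [X |-> E_X] is a bijection from
   smooth vector fields onto smooth 1-forms that matches symplectic fields with
   closed forms and Hamiltonian fields with exact ones. In particular every closed
   1-form is an Euler-Lagrange form, so both cohomology groups are the same
   quotient. *)

From HB Require Import structures.
Require Import Defs.
From mathcomp Require Import all_boot all_order all_algebra.
From mathcomp Require Import boolp classical_sets functions reals topology.
From mathcomp Require Import normedtype derive.
From mathcomp Require Import perm generic_quotient ring_quotient ring.
Set Implicit Arguments.
Unset Strict Implicit.
Unset Printing Implicit Defensive.

Import Order.TTheory GRing.Theory Num.Theory.
Import numFieldNormedType.Exports.

Local Open Scope classical_set_scope.
Local Open Scope ring_scope.

(** * Smooth functions on open subsets of R^m *)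

Section smooth_calculus.
Variables (R : realType) (m : nat).
Implicit Types (f g h : 'rV[R]_m -> R) (U : set 'rV[R]_m).

Lemma open_near U x : open U -> U x -> \forall y \near x, U y.
Proof. by move=> oU Ux; apply: open_nbhs_nbhs. Qed.

Lemma smooth_on_continuous U f x :
  smooth_on U f -> U x -> {for x, continuous f}.
Proof. by move=> sf Ux; have [] := sf [::] x Ux. Qed.

Lemma smooth_on_derivable U f i x :
  smooth_on U f -> U x -> derivable f x (basis_vec R i).
Proof. by move=> sf Ux; have [_] := sf [::] x Ux; apply. Qed.

Lemma smooth_on_partial U f i : smooth_on U f -> smooth_on U (partial i f).
Proof.
(* [iter_partial] is a right fold, so the last index of the list is applied first. *)
move=> sf s x Ux; have := sf (rcons s i) x Ux.
by rewrite /iter_partial -cats1 foldr_cat.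
Qed.

Lemma smooth_on_subset U V f : V `<=` U -> smooth_on U f -> smooth_on V f.
Proof. by move=> VU sf s x /VU; apply: sf. Qed.

Lemma near_eq_continuous f g x :
  {near x, f =1 g} -> {for x, continuous f} -> {for x, continuous g}.
Proof.
move=> fg cf; rewrite /prop_for /continuous_at -(nbhs_singleton fg).
exact: (cvg_trans (near_eq_cvg fg)).
Qed.

(* Coinduction: a class of regular functions stable under partial derivatives
   consists of smooth functions. This replaces Leibniz and quotient rules for
   derivatives of all orders. *)
Lemma smooth_on_coind U (S : ('rV[R]_m -> R) -> Prop) : open U ->
  (forall h x, S h -> U x ->
    {for x, continuous h} /\ forall i, derivable h x (basis_vec R i)) ->
  (forall h i, S h -> exists2 h', S h' & forall x, U x -> partial i h x = h' x) ->
  forall h, S h -> smooth_on U h.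
Proof.
move=> oU reg stab h Sh s.
(* Every iterated partial derivative of [h] agrees on [U] with a member of [S]; since [U] is open,
   regularity carries over. *)
have [h' S' e] : exists2 h', S h' & forall x, U x -> iter_partial s h x = h' x.
  elim: s => [|i s [h1 S1 e1]]; first by exists h.
  have [h2 S2 e2] := stab h1 i S1; exists h2 => // x Ux.
  rewrite /= -e2 //; apply: near_eq_derive.
  by apply: filterS (open_near oU Ux).
move=> x Ux; have [ch dh] := reg h' x S' Ux.
have nE : {near x, h' =1 iter_partial s h}.
  by apply: filterS (open_near oU Ux) => y Uy; rewrite /= e.
split; first exact: near_eq_continuous ch.
by move=> i; apply: near_eq_derivable (dh i).
Qed.

(** The class to which [smooth_on_coind] is applied. The rules for derivatives of sums, products and
    inverses stay inside it, and [smooth_algebra_eq] makes values outside [U] irrelevant. *)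
Inductive smooth_algebra U : ('rV[R]_m -> R) -> Prop :=
| smooth_algebra_base f : smooth_on U f -> smooth_algebra U f
| smooth_algebra_add f g : smooth_algebra U f -> smooth_algebra U g ->
    smooth_algebra U (f + g)
| smooth_algebra_mul f g : smooth_algebra U f -> smooth_algebra U g ->
    smooth_algebra U (f * g)
| smooth_algebra_inv f : smooth_algebra U f -> (forall x, U x -> f x != 0) ->
    smooth_algebra U (fun x => (f x)^-1)
| smooth_algebra_eq f g : smooth_algebra U f -> (forall x, U x -> f x = g x) ->
    smooth_algebra U g.

Lemma smooth_on_cst U (k : R) : smooth_on U (cst k).
Proof.
move=> s x Ux; have [l ->] : exists l, iter_partial s (cst k) = cst l.
  elim: s => [|i s [l IH]]; first by exists k.
  by exists 0; rewrite /= IH; apply/funext => y; rewrite /partial derive_cst.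
by split; [exact: cst_continuous|move=> i; exact: derivable_cst].
Qed.

Lemma smooth_algebra_reg U f x : open U -> smooth_algebra U f -> U x ->
  {for x, continuous f} /\ forall i, derivable f x (basis_vec R i).
Proof.
move=> oU sf Ux; elim: sf => {f}.
- by move=> f sf; have := sf [::] x Ux.
- move=> f g _ [cf df] _ [cg dg]; split; first exact: continuousD.
  by move=> i; exact: derivableD.
- move=> f g _ [cf df] _ [cg dg]; split; first exact: continuousM.
  by move=> i; exact: derivableM.
- move=> f _ [cf df] fN0; split; first by apply: continuousV => //; exact: fN0.
  by move=> i; apply: derivableV => //; exact: fN0.
- move=> f g _ [cf df] fg.
  have nE : {near x, f =1 g} by apply: filterS (open_near oU Ux).
  split; first exact: near_eq_continuous cf.
  by move=> i; apply: near_eq_derivable (df i).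
Qed.

Lemma smooth_algebra_partial U f i : open U -> smooth_algebra U f ->
  exists2 g, smooth_algebra U g & forall x, U x -> partial i f x = g x.
Proof.
move=> oU; elim=> {f}.
- move=> f sf; exists (partial i f) => //; apply: smooth_algebra_base.
  exact: smooth_on_partial.
- move=> f g sf [f' sf' ef] sg [g' sg' eg]; exists (f' + g').
    exact: smooth_algebra_add.
  move=> x Ux; rewrite /partial deriveD.
  + by rewrite -[RHS]/(f' x + g' x) -ef // -eg.
  + by have [_] := smooth_algebra_reg oU sf Ux; apply.
  by have [_] := smooth_algebra_reg oU sg Ux; apply.
- move=> f g sf [f' sf' ef] sg [g' sg' eg]; exists (f * g' + g * f').
    by apply: smooth_algebra_add; apply: smooth_algebra_mul.
  move=> x Ux; rewrite /partial deriveM.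
  + by have := ef x Ux; have := eg x Ux; rewrite /partial => -> ->.
  + by have [_] := smooth_algebra_reg oU sf Ux; apply.
  + by have [_] := smooth_algebra_reg oU sg Ux; apply.
- move=> f sf [f' sf' ef] fN0.
  (* The derivative [- f' / f ^ 2], written as a product of members of the class. *)
  exists (cst (-1) * ((fun x => (f x)^-1) * (fun x => (f x)^-1)) * f').
    have sfV := smooth_algebra_inv sf fN0.
    apply: smooth_algebra_mul => //; apply: smooth_algebra_mul.
      by apply: smooth_algebra_base; exact: smooth_on_cst.
    exact: smooth_algebra_mul.
  move=> x Ux; rewrite /partial deriveV ?fN0 //; last first.
    by have [_] := smooth_algebra_reg oU sf Ux; apply.
  have := ef x Ux; rewrite /partial => ->.
  rewrite -[RHS]/(-1 * ((f x)^-1 * (f x)^-1) * f' x) mulN1r -exprVn expr2.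
  by [].
- move=> f g sf [f' sf' ef] fg; exists f' => // x Ux; rewrite -ef //.
  apply: near_eq_derive; apply: filterS (open_near oU Ux) => y Uy.
  by rewrite fg.
Qed.

Lemma smooth_algebraP U f : open U -> smooth_algebra U f -> smooth_on U f.
Proof.
move=> oU; apply: (smooth_on_coind oU) => [h x|h i].
  exact: smooth_algebra_reg.
exact: smooth_algebra_partial.
Qed.

Lemma smooth_onD U f g : open U -> smooth_on U f -> smooth_on U g ->
  smooth_on U (f + g).
Proof.
move=> oU sf sg; apply: (smooth_algebraP oU).
by apply: smooth_algebra_add; exact: smooth_algebra_base.
Qed.

Lemma smooth_onM U f g : open U -> smooth_on U f -> smooth_on U g ->
  smooth_on U (f * g).
Proof.
move=> oU sf sg; apply: (smooth_algebraP oU).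
by apply: smooth_algebra_mul; exact: smooth_algebra_base.
Qed.

Lemma smooth_onV U f : open U -> smooth_on U f -> (forall x, U x -> f x != 0) ->
  smooth_on U (fun x => (f x)^-1).
Proof.
move=> oU sf fN0; apply: (smooth_algebraP oU).
by apply: smooth_algebra_inv => //; exact: smooth_algebra_base.
Qed.

Lemma eq_smooth_on U f g : open U -> (forall x, U x -> f x = g x) ->
  smooth_on U f -> smooth_on U g.
Proof.
move=> oU fg sf; apply: (smooth_algebraP oU).
by apply: smooth_algebra_eq fg; exact: smooth_algebra_base.
Qed.

(** * Mean value theorem along lines and symmetry of second derivatives *)

Lemma is_derive_line f x v (t : R) : derivable f (x + t *: v) v ->
  is_derive t 1 (fun s : R => f (x + s *: v)) ('D_v f (x + t *: v)).
Proof.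
move=> df; have E : (fun h : R => h^-1 *:
    (((fun s : R => f (x + s *: v)) \o shift t) (h *: 1) - f (x + t *: v))) =
    (fun h : R => h^-1 *: ((f \o shift (x + t *: v)) (h *: v) - f (x + t *: v))).
  apply/funext => h /=; congr (_ *: (f _ - _)).
  by rewrite [_%:A]mulr1 scalerDl addrCA.
by apply: DeriveDef; rewrite /derivable /derive E.
Qed.

(** Mean value theorem in one variable for [s |-> f (x + s *: v)]. Bounding [s] by absolute values
    treats both signs of [t] at once. *)
Lemma MVT_line f x v (t : R) :
  (forall s : R, `|s| <= `|t| -> derivable f (x + s *: v) v) ->
  exists2 c : R, `|c| <= `|t| &
    f (x + t *: v) - f x = t * 'D_v f (x + c *: v).
Proof.
move=> df; pose F s := f (x + s *: v); pose dFv s := 'D_v f (x + s *: v).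
have F0 : F 0 = f x by rewrite /F scale0r addr0.
have dF (s : R) : `|s| <= `|t| -> is_derive s 1 F ('D_v f (x + s *: v)).
  by move=> /df/is_derive_line.
have cF (a b : R) : (forall s, s \in `[a, b] -> `|s| <= `|t|) ->
    {within `[a, b], continuous F}.
  move=> H; apply: derivable_within_continuous => s sab.
  by have [] := dF s (H s sab).
have [t0|/ltW t0] := leP 0 t.
  have H s : s \in `[0, t] -> `|s| <= `|t|.
    by rewrite in_itv => /andP[s0 st]; rewrite !ger0_norm.
  have [|c cI e] := @MVT_segment R F dFv _ _ t0 _ (cF _ _ H).
    by move=> s sI; apply/dF/H; exact: subset_itv_oo_cc.
  by exists c; [exact: H|rewrite -/(F t) -F0 e subr0 mulrC].
have H s : s \in `[t, 0] -> `|s| <= `|t|.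
  by rewrite in_itv => /andP[ts s0]; rewrite !ler0_norm ?lerN2.
have [|c cI e] := @MVT_segment R F dFv _ _ t0 _ (cF _ _ H).
  by move=> s sI; apply/dF/H; exact: subset_itv_oo_cc.
by exists c; [exact: H|rewrite -/(F t) -F0 -opprB e sub0r mulrN opprK mulrC].
Qed.

Lemma translate_growth_rate f a v x :
  (fun h : R => h^-1 *: (((fun y => f (y + a)) \o shift x) (h *: v) - f (x + a)))
  = (fun h : R => h^-1 *: ((f \o shift (x + a)) (h *: v) - f (x + a))).
Proof. by apply/funext => h /=; rewrite addrA. Qed.

Lemma derivable_translate f a v x :
  derivable f (x + a) v -> derivable (fun y => f (y + a)) x v.
Proof. by rewrite /derivable translate_growth_rate. Qed.

Lemma derive_translate f a v x : 'D_v (fun y => f (y + a)) x = 'D_v f (x + a).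
Proof. by rewrite /derive translate_growth_rate. Qed.

Lemma ball_smallP U x : open U -> U x ->
  exists2 r : R, 0 < r & forall y, `|y - x| < r -> U y.
Proof.
move=> oU Ux; have /nbhs_ballP[r /= r0 H] := open_near oU Ux.
exists r => // y yx; apply: H.
by rewrite -ball_normE /= distrC.
Qed.

(** Mean value theorem twice: for [G] along [u], then for ['D_u f] along [v]. The left side is
    symmetric in [u] and [v], so exchanging them expresses the same number by the other mixed
    derivative. *)
Lemma second_difference f x r (u v : 'rV[R]_m) (a : R) :
  (forall y, `|y - x| < r -> derivable f y u /\ derivable ('D_u f) y v) ->
  `|a| * (`|u| + `|v|) < r ->
  exists2 y, `|y - x| < r &
    f (x + a *: u + a *: v) - f (x + a *: u) - f (x + a *: v) + f x =
    a * (a * 'D_v ('D_u f) y).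
Proof.
move=> df ar.
(* The bound on [a] keeps all intermediate points in the ball around [x]. *)
have small (s t : R) : `|s| <= `|a| -> `|t| <= `|a| ->
    `|x + s *: u + t *: v - x| < r.
  move=> sa ta; rewrite (_ : _ - x = s *: u + t *: v); last first.
    by rewrite addrC !addrA addNr add0r.
  apply: le_lt_trans ar; apply: le_trans (ler_normD _ _) _.
  by rewrite !normrZ mulrDr lerD // ler_wpM2r.
pose G y := f (y + a *: v) - f y.
have dG s : `|s| <= `|a| -> derivable G (x + s *: u) u /\
    'D_u G (x + s *: u) = 'D_u f (x + s *: u + a *: v) - 'D_u f (x + s *: u).
  move=> sa.
  have [d1 _] := df _ (small s a sa (lexx _)).
  have := small s 0 sa; rewrite scale0r addr0 normr0 => /(_ (normr_ge0 _)).
  move=> /df[d2 _].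
  have d1' := derivable_translate d1.
  have GE : G = (fun y => f (y + a *: v)) - f by [].
  rewrite GE; split; first exact: (derivableB d1' d2).
  by rewrite (deriveB d1' d2) derive_translate.
have [|c ca] := @MVT_line G x u a; first by move=> s /dG[].
rewrite (dG c ca).2; have [|d da ->] := @MVT_line ('D_u f) (x + c *: u) v a.
  by move=> s sa; have [] := df _ (small c s ca sa).
move=> e; exists (x + c *: u + d *: v); first exact: small.
by rewrite -e /G opprB addrA [in RHS]addrAC.
Qed.

(** Triangle inequality. In [partialC], [a] and [b] are the two mixed derivatives at [x], and [c] is
    a value that both of them take near [x]. *)
Lemma half_dist_absurd (a b c : R) :
  `|a - c| < `|a - b| / 2 -> `|b - c| < `|a - b| / 2 -> False.
Proof.
move=> ac bc; have := ltrD ac bc; rewrite -splitr ltNge => /negP; apply.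
by rewrite [`|b - c|]distrC; exact: ler_distD.
Qed.

(* The second difference quotient is a value of both mixed derivatives near [x]. *)
Lemma partialC U f i j x : open U -> smooth_on U f -> U x ->
  partial i (partial j f) x = partial j (partial i f) x.
Proof.
move=> oU sf Ux; apply/eqP; apply: contraT => ne.
set A := partial i _ _ in ne *; set B := partial j _ _ in ne *.
pose e := `|A - B| / 2.
have e0 : 0 < e by rewrite divr_gt0 // normr_gt0 subr_eq0.
have [r r0 Hr] := ball_smallP oU Ux.
have close h y0 : {for x, continuous h} -> h x = y0 ->
    exists2 r : R, 0 < r & forall y, `|y - x| < r -> `|y0 - h y| < e.
  move=> ch <-; have /cvgrPdist_lt/(_ _ e0)/nbhs_ballP[r' /= r'0 H] := ch.
  by exists r' => // y yx; apply: H; rewrite -ball_normE /= distrC.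
have cont a b : {for x, continuous (partial a (partial b f))}.
  exact: (sf [:: a; b] x Ux).1.
have [r1 r10 H1] := close _ A (cont i j) erefl.
have [r2 r20 H2] := close _ B (cont j i) erefl.
pose q := Num.min r (Num.min r1 r2).
have q0 : 0 < q by rewrite !lt_min r0 r10.
pose N := `|basis_vec R i| + `|basis_vec R j|.
have N0 : 0 < 1 + N by rewrite ltr_pwDl // addr_ge0.
(* Small enough for [|a| * N < q]; the summand 1 keeps the denominator positive. *)
pose a := q / (1 + N).
have a0 : 0 < a by rewrite divr_gt0.
have aN : `|a| * N < q.
  rewrite gtr0_norm // /a mulrAC -mulrA gtr_pMr // ltr_pdivrMr // mul1r.
  by rewrite ltrDr.
have df u v y : `|y - x| < q -> derivable f y (basis_vec R u) /\
    derivable ('D_(basis_vec R u) f) y (basis_vec R v).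
  rewrite lt_min => /andP[/Hr Uy _]; split; first exact: smooth_on_derivable Uy.
  exact: (sf [:: u] y Uy).2.
have aN' : `|a| * (`|basis_vec R j| + `|basis_vec R i|) < q by rewrite addrC.
have [y yq ey] := second_difference (df j i) aN'.
have [z zq ez] := second_difference (df i j) aN.
(* Both sides, multiplied by [a] twice, are the same second difference of [f] at [x]. *)
have E : 'D_(basis_vec R i) ('D_(basis_vec R j) f) y =
         'D_(basis_vec R j) ('D_(basis_vec R i) f) z.
  have aI (s t : R) : a * (a * s) = a * (a * t) -> s = t.
    by have aa : a != 0 by [rewrite gt_eqF]; move=> /(mulfI aa)/(mulfI aa).
  apply: aI; apply: etrans (esym ey) _; apply: etrans _ ez.
  by rewrite [x + _ + _]addrAC; congr (_ + _); exact: addrAC.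
move: yq zq; rewrite !lt_min => /andP[_ /andP[/H1 h1 _]] /andP[_ /andP[_ /H2 h2]].
case: (half_dist_absurd h1); rewrite (_ : partial i _ y = partial j (partial i f) z) //.
Qed.

End smooth_calculus.

(** * The chain rule for smooth functions of several variables *)

Section chain_rule.
Variables (R : realType) (n : nat).
Implicit Types (y z u : 'rV[R]_n) (F : 'rV[R]_n -> R).

Lemma rV_norm_le u (e : R) : 0 <= e -> (forall j, `|u 0 j| <= e) -> `|u| <= e.
Proof.
move=> e0 ue; rewrite /Num.Def.normr/= mx_normrE (bigmax_le _ e0) //= => -[i j] _.
by rewrite ord1.
Qed.

Lemma rV_coord_le u j : `|u 0 j| <= `|u|.
Proof.
rewrite [leRHS]/Num.Def.normr/= mx_normrE.
exact: (@le_bigmax _ _ _ _ (fun i : 'I_1 * 'I_n => `|u i.1 i.2|) (0, j)).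
Qed.

(** The vertices of a staircase from [y] (at [k = 0]) to [z] (at [k = n]), each edge parallel to one
    axis, so that partial derivatives suffice along it. *)
Definition partway y z (k : nat) : 'rV[R]_n :=
  \row_j (if (j < k)%N then z 0 j else y 0 j).

Lemma partwayS y z (k : 'I_n) :
  partway y z k.+1 = partway y z k + (z 0 k - y 0 k) *: basis_vec R k.
Proof.
apply/rowP => j; rewrite !mxE eqxx /= ltnS leq_eqVlt -val_eqE /=.
have [jk|_ /=] := eqVneq (val j) k; last by rewrite mulr0 addr0.
have -> : j = k by exact: val_inj.
by rewrite ltnn mulr1 addrC subrK.
Qed.

(** The increment telescopes along the staircase [partway y z], and the mean value theorem applies
    on each edge. *)
Lemma increment_partial F y z (r : R) :
  (forall u k, `|u - y| < r -> derivable F u (basis_vec R k)) -> `|z - y| < r ->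
  exists xi : 'I_n -> 'rV[R]_n, (forall k, `|xi k - y| <= `|z - y|) /\
    F z - F y = \sum_k (z 0 k - y 0 k) * partial k F (xi k).
Proof.
move=> dF zr.
(* The norm is the maximum norm, so the staircase never gets farther from [y] than [z] is. *)
have small (k : 'I_n) (s : R) : `|s| <= `|z 0 k - y 0 k| ->
    `|partway y z k + s *: basis_vec R k - y| <= `|z - y|.
  move=> sk; apply: rV_norm_le => // j; rewrite !mxE eqxx /=.
  have [->|_] := eqVneq j k.
    rewrite ltnn mulr1 addrAC subrr add0r; apply: le_trans sk _.
    by have := rV_coord_le (z - y) k; rewrite !mxE.
  rewrite mulr0 addr0; case: ifP => _; last by rewrite subrr normr0.
  by have := rV_coord_le (z - y) j; rewrite !mxE.
have step (k : 'I_n) : exists u, `|u - y| <= `|z - y| /\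
    F (partway y z k.+1) - F (partway y z k) = (z 0 k - y 0 k) * partial k F u.
  have [|c ck e] := @MVT_line _ _ F (partway y z k) (basis_vec R k) (z 0 k - y 0 k).
    by move=> s sk; apply: dF; apply: le_lt_trans zr; exact: small.
  exists (partway y z k + c *: basis_vec R k); split; first exact: small.
  by rewrite partwayS.
have [xi Hxi] := choice step.
exists xi; split; first by move=> k; have [] := Hxi k.
transitivity (\sum_(k < n) (F (partway y z k.+1) - F (partway y z k))).
  rewrite -(big_mkord xpredT (fun k => F (partway y z k.+1) - F (partway y z k))).
  rewrite telescope_sumr //; congr (F _ - F _); apply/rowP => j; rewrite !mxE //.
  by rewrite ltn_ord.
by apply: eq_bigr => k _; have [] := Hxi k.
Qed.

(** [increment_partial] is divided by [h]; the intermediate points tend to [G a], where the partial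
    derivatives of [F] are continuous, and the limit is taken termwise. *)
Lemma chain_rule (V : normedModType R) U F (G : V -> 'rV[R]_n) (a v : V) :
  open U -> smooth_on U F -> U (G a) ->
  (forall k, derivable (fun x => G x 0 k) a v) ->
  is_derive a v (F \o G)
    (\sum_k 'D_v (fun x => G x 0 k) a * partial k F (G a)).
Proof.
move=> oU sF Ua dG; have [r r0 Hr] := ball_smallP oU Ua.
(* Derivability along [v] gives continuity at [a] along the line in direction [v]. *)
have cG (k : 'I_n) : (fun h : R => G (h *: v + a) 0 k) @ 0^' --> G a 0 k.
  have : {for 0, continuous (fun h : R => G (h *: v + a) 0 k)}.
    have D := (derivable1P _ _ _).1 (dG k).
    exact: differentiable_continuous ((derivable1_diffP _ _).1 D).
  by move=> /continuous_withinNx; rewrite scale0r add0r.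
have nG (e : R) : 0 < e -> \forall h \near (0 : R)^', `|G (h *: v + a) - G a| <= e.
  move=> e0; near=> h; apply: rV_norm_le; first exact: ltW.
  move=> j; rewrite !mxE distrC.
  move: j; near: h; apply: filter_forall => j.
  by have /cvgrPdist_le/(_ _ e0) := cG j.
have r2 : 0 < r / 2 by rewrite divr_gt0.
have half_lt (e : R) : e <= r / 2 -> e < r.
  by move=> er; apply: le_lt_trans er _; rewrite ltr_pdivrMr // ltr_pMr // ltr1n.
(* The bound is a premise under the existential so that [choice] gives points for every [h]; when it
   fails, they are 0 by default. *)
have inc (h : R) : exists xi : 'I_n -> 'rV[R]_n, `|G (h *: v + a) - G a| < r ->
    (forall k, `|xi k - G a| <= `|G (h *: v + a) - G a|) /\
    F (G (h *: v + a)) - F (G a) =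
      \sum_k (G (h *: v + a) 0 k - G a 0 k) * partial k F (xi k).
  have [hr|] := pselect (`|G (h *: v + a) - G a| < r); last first.
    by move=> hr; exists (fun=> 0).
  have [|xi Hxi] := @increment_partial F (G a) (G (h *: v + a)) r _ hr.
    by move=> u k /Hr Uu; exact: smooth_on_derivable sF Uu.
  by exists xi.
have [xi Hxi] := choice inc.
have cxi k : (fun h => partial k F (xi h k)) @ (0 : R)^' --> partial k F (G a).
  have cF : {for G a, continuous (partial k F)}.
    exact: smooth_on_continuous (smooth_on_partial k sF) Ua.
  apply: (continuous_cvg _ cF); apply/cvgrPdist_le => /= e e0.
  near=> h; rewrite distrC.
  have hr : `|G (h *: v + a) - G a| < r.
    by apply: half_lt; near: h; exact: nG.
  have [/(_ k) h1 _] := Hxi h hr; apply: le_trans h1 _.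
  by near: h; exact: nG.
suff L : (fun h : R => h^-1 *: (((F \o G) \o shift a) (h *: v) - (F \o G) a)) @ 0^'
    --> \sum_k 'D_v (fun x => G x 0 k) a * partial k F (G a).
  by apply: DeriveDef; [apply/cvg_ex; eexists; exact: L|exact: cvg_lim L].
have E : {near (0 : R)^', (fun h => \sum_k
       (h^-1 *: (G (h *: v + a) 0 k - G a 0 k)) * partial k F (xi h k)) =1
     (fun h : R => h^-1 *: (((F \o G) \o shift a) (h *: v) - (F \o G) a))}.
  near=> h.
  have hr : `|G (h *: v + a) - G a| < r.
    by apply: half_lt; near: h; exact: nG.
  have [_ /= ->] := Hxi h hr.
  by rewrite scaler_sumr; apply: eq_bigr => k _; rewrite -scalerAl.
apply: (cvg_trans (near_eq_cvg E)).
apply: cvg_big => [|k _]; first exact: add_continuous.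
by apply: cvgM; [exact: dG|exact: cxi].
Unshelve. all: by end_near. Qed.

End chain_rule.

(** * Calculus in charts *)

Section chart_calculus.
Variables (R : realType) (m : nat) (M : smoothManifold R m).
Implicit Types (c d : chart_idx M) (p q : M) (f g : M -> R) (V : set M).

(* [f] is smooth on [chart_dom c `&` V] in the coordinates of [c]. The open set [V]
   is needed for coordinates of other charts, smooth on an intersection only. *)
Definition smooth_near c V f :=
  smooth_on (chart_map (charts c) @` (chart_dom (charts c) `&` V))
            (f \o chart_inv (charts c)).

(** The inverse chart is continuous on its open codomain, so it pulls [V] back to a neighbourhood of
    each image point. *)
Lemma chart_image_open c V : open V ->
  open (chart_map (charts c) @` (chart_dom (charts c) `&` V)).
Proof.
move=> oV; rewrite openE => _ [p [cp Vp] <-]; rewrite /interior.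
have cmp : chart_codom (charts c) (chart_map (charts c) p) by exists p.
have ci : {for chart_map (charts c) p, continuous (chart_inv (charts c))}.
  by apply: (@chart_inv_continuous _ _ _ (charts c)); rewrite inE.
have nV : \forall y \near chart_map (charts c) p, V (chart_inv (charts c) y).
  apply: ci; rewrite chart_mapK ?inE //; exact: open_nbhs_nbhs.
have nC := open_near (@chart_codom_open _ _ _ (charts c)) cmp.
apply: filterS2 nV nC => y Vy [q cq qy]; move: Vy.
by rewrite -qy chart_mapK ?inE // => Vq; exists q.
Qed.

(** Turns identities on [chart_dom c] and [V] into identities near a point of R^m, the form in which
    derivatives can use them. *)
Lemma chart_near c V p (P : M -> Prop) : open V ->
  chart_dom (charts c) p -> V p ->
  (forall q, chart_dom (charts c) q -> V q -> P q) ->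
  \forall y \near chart_map (charts c) p, P (chart_inv (charts c) y).
Proof.
move=> oV cp Vp H.
have := open_near (chart_image_open oV) (ex_intro2 _ _ p (conj cp Vp) erefl).
by apply: filterS => _ [q [cq Vq] <-]; rewrite chart_mapK ?inE //; apply: H.
Qed.

Lemma smooth_near_setT c f : smooth_near c setT f <-> smooth_in c f.
Proof. by rewrite /smooth_near setIT. Qed.

Lemma smooth_in_near c V f : smooth_in c f -> smooth_near c V f.
Proof. by apply: smooth_on_subset => _ [q [cq _] <-]; exists q. Qed.

Lemma smooth_near_coord c d j :
  smooth_near c (chart_dom (charts d)) (chart_coord (charts d) j).
Proof. exact: transition_smooth. Qed.

Lemma smooth_in_coord c j : smooth_in c (chart_coord (charts c) j).
Proof. by have := @smooth_near_coord c c j; rewrite /smooth_near setIid. Qed.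

Section at_open.
Variables (c : chart_idx M) (V : set M).
Hypothesis oV : open V.
Local Notation D := (chart_dom (charts c)).
Let oU := @chart_image_open c _ oV.

Lemma eq_smooth_near f g : (forall q, D q -> V q -> f q = g q) ->
  smooth_near c V f -> smooth_near c V g.
Proof.
move=> fg; apply: eq_smooth_on => // _ [q [cq Vq] <-] /=.
by rewrite chart_mapK ?inE // fg.
Qed.

Lemma smooth_nearD f g :
  smooth_near c V f -> smooth_near c V g -> smooth_near c V (f + g).
Proof. exact: smooth_onD oU. Qed.

Lemma smooth_nearM f g :
  smooth_near c V f -> smooth_near c V g -> smooth_near c V (f * g).
Proof. exact: smooth_onM oU. Qed.

Lemma smooth_near_cst (k : R) : smooth_near c V (cst k).
Proof. exact: smooth_on_cst. Qed.

Lemma smooth_nearV f : smooth_near c V f ->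
  (forall q, D q -> V q -> f q != 0) -> smooth_near c V (fun q => (f q)^-1).
Proof.
move=> sf fN0; apply: (smooth_onV oU sf) => _ [q [cq Vq] <-] /=.
by rewrite chart_mapK ?inE // fN0.
Qed.

Lemma smooth_nearN f : smooth_near c V f -> smooth_near c V (- f).
Proof.
move=> sf; apply: eq_smooth_near (smooth_nearM (smooth_near_cst (-1)) sf) => q _ _.
exact: mulN1r.
Qed.

Lemma smooth_nearB f g :
  smooth_near c V f -> smooth_near c V g -> smooth_near c V (f - g).
Proof. by move=> sf /smooth_nearN; exact: smooth_nearD sf. Qed.

Lemma smooth_near_sum (I : Type) (r : seq I) (F : I -> M -> R) :
  (forall i, smooth_near c V (F i)) ->
  smooth_near c V (fun q => \sum_(i <- r) F i q).
Proof.
move=> sF; elim: r => [|i r IH].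
  apply: eq_smooth_near (smooth_near_cst 0) => q _ _; by rewrite big_nil.
by apply: eq_smooth_near (smooth_nearD (sF i) IH) => q _ _; rewrite big_cons.
Qed.

Lemma smooth_near_prod (I : Type) (r : seq I) (F : I -> M -> R) :
  (forall i, smooth_near c V (F i)) ->
  smooth_near c V (fun q => \prod_(i <- r) F i q).
Proof.
move=> sF; elim: r => [|i r IH].
  apply: eq_smooth_near (smooth_near_cst 1) => q _ _; by rewrite big_nil.
by apply: eq_smooth_near (smooth_nearM (sF i) IH) => q _ _; rewrite big_cons.
Qed.

(** The Leibniz expansion makes the determinant a polynomial in the entries. *)
Lemma smooth_near_det n (A : M -> 'M[R]_n) :
  (forall i j, smooth_near c V (fun q => A q i j)) ->
  smooth_near c V (fun q => \det (A q)).
Proof.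
move=> sA; apply: smooth_near_sum => s.
have sP := smooth_near_prod (index_enum _) (fun i => sA i (s i)).
exact: (smooth_nearM (smooth_near_cst ((-1) ^+ s)) sP).
Qed.

(** Cramer's rule: an entry of the inverse is a cofactor, with transposed indices, divided by the
    determinant. *)
Lemma smooth_near_invmx n (A : M -> 'M[R]_n) i j :
  (forall i j, smooth_near c V (fun q => A q i j)) ->
  (forall q, D q -> V q -> A q \in unitmx) ->
  smooth_near c V (fun q => invmx (A q) i j).
Proof.
move=> sA uA.
pose g q := (\det (A q))^-1 * ((-1) ^+ (j + i) * \det (row' j (col' i (A q)))).
apply: (@eq_smooth_near g) => [q Dq Vq|].
  by rewrite /invmx uA // !mxE.
have sV : smooth_near c V (fun q => (\det (A q))^-1).
  apply: smooth_nearV => [|q Dq Vq]; first exact: smooth_near_det.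
  by rewrite -unitfE -unitmxE uA.
have sC : smooth_near c V (fun q => \det (row' j (col' i (A q)))).
  apply: smooth_near_det => k l.
  by apply: eq_smooth_near (sA (lift j k) (lift i l)) => q _ _; rewrite !mxE.
exact: (smooth_nearM sV (smooth_nearM (smooth_near_cst ((-1) ^+ (j + i))) sC)).
Qed.

Lemma smooth_near_pderiv i f :
  smooth_near c V f -> smooth_near c V (pderiv c i f).
Proof.
move=> sf; apply: (@eq_smooth_on _ _ _ _ _ oU _ (smooth_on_partial i sf)).
by move=> _ [q [cq _] <-]; rewrite /pderiv /= chart_mapK ?inE.
Qed.

Variable p : M.
Hypotheses (Dp : D p) (Vp : V p).
Let Up : (chart_map (charts c) @` (D `&` V)) (chart_map (charts c) p).
Proof. by exists p. Qed.

Lemma eq_pderiv i f g : (forall q, D q -> V q -> f q = g q) ->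
  pderiv c i f p = pderiv c i g p.
Proof. by move=> fg; apply: near_eq_derive; exact: chart_near fg. Qed.

Let df f i : smooth_near c V f -> derivable (f \o chart_inv (charts c))
  (chart_map (charts c) p) (basis_vec R i).
Proof. by move=> sf; exact: smooth_on_derivable sf Up. Qed.

Lemma pderivD i f g : smooth_near c V f -> smooth_near c V g ->
  pderiv c i (f + g) p = pderiv c i f p + pderiv c i g p.
Proof. by move=> /(@df _ i) sf /(@df _ i) sg; exact: (deriveD sf sg). Qed.

Lemma pderivM i f g : smooth_near c V f -> smooth_near c V g ->
  pderiv c i (f * g) p = f p * pderiv c i g p + g p * pderiv c i f p.
Proof.
move=> /(@df _ i) sf /(@df _ i) sg; apply: etrans (deriveM sf sg) _.
by rewrite /= chart_mapK ?inE.
Qed.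

Lemma pderiv_cst i (k : R) : pderiv c i (cst k) p = 0.
Proof. exact: (derive_cst (k : R)). Qed.

Lemma pderivN i f : smooth_near c V f -> pderiv c i (- f) p = - pderiv c i f p.
Proof. by move=> /(@df _ i) sf; exact: (deriveN sf). Qed.

Lemma pderivB i f g : smooth_near c V f -> smooth_near c V g ->
  pderiv c i (f - g) p = pderiv c i f p - pderiv c i g p.
Proof. by move=> /(@df _ i) sf /(@df _ i) sg; exact: (deriveB sf sg). Qed.

Lemma pderiv_sum (I : Type) (r : seq I) (F : I -> M -> R) i :
  (forall j, smooth_near c V (F j)) ->
  pderiv c i (fun q => \sum_(j <- r) F j q) p = \sum_(j <- r) pderiv c i (F j) p.
Proof.
move=> sF; elim: r => [|j r IH].
  rewrite big_nil; apply: etrans (pderiv_cst i 0).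
  by apply: eq_pderiv => q _ _; rewrite big_nil.
rewrite big_cons -IH -pderivD //; last exact: smooth_near_sum.
by apply: eq_pderiv => q _ _; rewrite big_cons.
Qed.

Lemma pderivC i j f : smooth_near c V f ->
  pderiv c i (pderiv c j f) p = pderiv c j (pderiv c i f) p.
Proof.
move=> sf.
transitivity (partial i (partial j (f \o chart_inv (charts c)))
  (chart_map (charts c) p)).
  apply: near_eq_derive; apply: filterS (open_near oU Up) => _ [q [Dq _] <-].
  by rewrite /pderiv /= chart_mapK ?inE.
rewrite (partialC _ _ oU sf Up).
apply: near_eq_derive; apply: filterS (open_near oU Up) => _ [q [Dq _] <-].
by rewrite /pderiv /= chart_mapK ?inE.
Qed.

(** The chain rule for [G], the transition map from [c] to [d]. In the coordinates of [c], [f] is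
    the composite of its expression in [d] with [G], but only near [x]. *)
Lemma pderiv_change d i f : chart_dom (charts d) p -> smooth_near d V f ->
  pderiv c i f p =
  \sum_j pderiv c i (chart_coord (charts d) j) p * pderiv d j f p.
Proof.
move=> dp sf; set x := chart_map (charts c) p.
pose G := chart_map (charts d) \o chart_inv (charts c).
have Gx : G x = chart_map (charts d) p by rewrite /G /= chart_mapK ?inE.
have Ud : (chart_map (charts d) @` (chart_dom (charts d) `&` V)) (G x).
  by rewrite Gx; exists p.
have dG k : derivable (fun y => G y 0 k) x (basis_vec R i).
  have sk : smooth_on _ (fun y => G y 0 k) := @smooth_near_coord c d k.
  have cdp : (chart_map (charts c) @`
      (chart_dom (charts c) `&` chart_dom (charts d))) x by exists p.
  exact: smooth_on_derivable sk cdp.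
have [_] := chain_rule (chart_image_open oV) sf Ud dG.
rewrite Gx => <-; apply: near_eq_derive.
have := open_near (@chart_image_open c _ (@chart_dom_open _ _ _ (charts d)))
  (ex_intro2 _ _ p (conj Dp dp) erefl).
apply: filterS => _ [q [cq dq] <-].
have cK : chart_inv (charts c) (chart_map (charts c) q) = q.
  by rewrite chart_mapK ?inE.
by rewrite /G /= cK chart_mapK ?inE.
Qed.

End at_open.

Lemma pderiv_coord c i j p : chart_dom (charts c) p ->
  pderiv c i (chart_coord (charts c) j) p = (i == j)%:R.
Proof.
move=> cp; set x := chart_map (charts c) p.
have cx : chart_codom (charts c) x by exists p.
transitivity ('D_(basis_vec R i) (fun y : 'rV[R]_m => y 0 j) x).
  apply: near_eq_derive.
  apply: filterS (open_near (@chart_codom_open _ _ _ (charts c)) cx) => _ [q cq <-].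
  by rewrite /chart_coord /= chart_mapK ?inE.
(* The increment is linear in [h], so the quotient is constant for nonzero [h]. *)
have E : (fun h : R => h^-1 *: (((fun y : 'rV[R]_m => y 0 j) \o shift x)
    (h *: basis_vec R i) - x 0 j)) = (fun h : R => h^-1 * (h * (i == j)%:R)).
  apply/funext => h; rewrite /= !mxE eqxx /= [j == i]eq_sym addrK.
  by [].
rewrite /derive E; apply/lim_near_cst => //=.
by near=> h; rewrite mulKf //; near: h; exact: nbhs_dnbhs_neq.
Unshelve. all: by end_near. Qed.

End chart_calculus.

(** * Vector fields and their bracket *)

Section vector_fields.
Variables (R : realType) (m : nat) (M : smoothManifold R m).
Implicit Types (c d : chart_idx M) (p q : M) (f g : M -> R) (V : set M).
Implicit Types (X Y Z : M -> 'rV[R]_m).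
Local Notation dom c := (chart_dom (charts c)).
Local Notation coord c := (chart_coord (charts c)).

Lemma dom_open c : open (dom c).
Proof. exact: chart_dom_open. Qed.

(** [vaction] is defined through [chart_at p]; a change of variables allows any chart around [p].
    All later computations in a fixed chart rest on this. *)
Lemma vactionE c V p X f : open V -> dom c p -> V p -> smooth_near c V f ->
  vaction X f p = \sum_j vaction X (coord c j) p * pderiv c j f p.
Proof.
move=> oV cp Vp sf; rewrite /vaction.
under eq_bigr => i _ do
  rewrite (pderiv_change oV (mem_chart_at p) Vp i cp sf) mulr_sumr.
rewrite exchange_big; apply: eq_bigr => j _.
by rewrite mulr_suml; apply: eq_bigr => i _; rewrite mulrA.
Qed.

Lemma vaction_coord X p j : vaction X (coord (chart_at p) j) p = X p 0 j.
Proof.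
rewrite /vaction (bigD1 j) //= pderiv_coord ?eqxx ?mulr1; last exact: mem_chart_at.
rewrite big1 ?addr0 // => i /negPf ij.
by rewrite pderiv_coord ?ij ?mulr0 //; exact: mem_chart_at.
Qed.

(** A component of [X p] is the action of [X] on a coordinate of [chart_at p], to which [vactionE]
    applies. *)
Lemma coord_decomposition c p X : dom c p ->
  X p = \sum_j vaction X (coord c j) p *: coord_vec c j p.
Proof.
move=> cp; apply/rowP => k; rewrite summxE -vaction_coord.
rewrite (vactionE X (dom_open (chart_at p)) cp (mem_chart_at p)
  (@smooth_near_coord _ _ M c (chart_at p) k)).
by apply: eq_bigr => j _; rewrite !mxE.
Qed.

Lemma coord_vec_chart_at p i : coord_vec (chart_at p) i p = delta_mx 0 i.
Proof.
apply/rowP => j; rewrite !mxE pderiv_coord ?eqxx /=; last exact: mem_chart_at.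
by rewrite eq_sym.
Qed.

Lemma eq_vaction c V p X f g : open V -> dom c p -> V p ->
  smooth_near c V f -> (forall q, dom c q -> V q -> f q = g q) ->
  vaction X f p = vaction X g p.
Proof.
move=> oV cp Vp sf fg; have sg := eq_smooth_near oV fg sf.
rewrite (vactionE X oV cp Vp sf) (vactionE X oV cp Vp sg).
by apply: eq_bigr => j _; rewrite (eq_pderiv oV cp Vp j fg).
Qed.

Lemma smooth_near_vaction c V X f : open V -> smooth_vfield X ->
  smooth_near c V f -> smooth_near c V (vaction X f).
Proof.
move=> oV sX sf.
have E q : dom c q -> V q ->
    \sum_j (vaction X (coord c j) * pderiv c j f) q = vaction X f q.
  by move=> cq Vq; rewrite (vactionE X oV cq Vq sf).
have sXj j : smooth_near c V (vaction X (coord c j)).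
  by apply: smooth_in_near; exact: sX.
have sG := smooth_near_sum oV (index_enum _)
  (fun j => smooth_nearM oV (sXj j) (smooth_near_pderiv oV j sf)).
exact: (eq_smooth_near oV E sG).
Qed.

Lemma vactionB c V p X f g : open V -> dom c p -> V p ->
  smooth_near c V f -> smooth_near c V g ->
  vaction X (f - g) p = vaction X f p - vaction X g p.
Proof.
move=> oV cp Vp sf sg; rewrite (vactionE X oV cp Vp (smooth_nearB oV sf sg)).
rewrite (vactionE X oV cp Vp sf) (vactionE X oV cp Vp sg) -sumrB.
by apply: eq_bigr => j _; rewrite (pderivB cp Vp j sf sg) mulrBr.
Qed.

Lemma vactionD c V p X f g : open V -> dom c p -> V p ->
  smooth_near c V f -> smooth_near c V g ->
  vaction X (f + g) p = vaction X f p + vaction X g p.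
Proof.
move=> oV cp Vp sf sg; rewrite (vactionE X oV cp Vp (smooth_nearD oV sf sg)).
rewrite (vactionE X oV cp Vp sf) (vactionE X oV cp Vp sg) -big_split.
by apply: eq_bigr => j _; rewrite (pderivD cp Vp j sf sg) mulrDr.
Qed.

Lemma vactionM c V p X f g : open V -> dom c p -> V p ->
  smooth_near c V f -> smooth_near c V g ->
  vaction X (f * g) p = f p * vaction X g p + g p * vaction X f p.
Proof.
move=> oV cp Vp sf sg; rewrite (vactionE X oV cp Vp (smooth_nearM oV sf sg)).
rewrite (vactionE X oV cp Vp sf) (vactionE X oV cp Vp sg) !mulr_sumr -big_split.
by apply: eq_bigr => j _; rewrite (pderivM cp Vp j sf sg) mulrDr !mulrA
  [_ * f p]mulrC [_ * g p]mulrC.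
Qed.

Lemma vaction_sum c V p X (I : Type) (r : seq I) (F : I -> M -> R) :
  open V -> dom c p -> V p -> (forall j, smooth_near c V (F j)) ->
  vaction X (fun q => \sum_(j <- r) F j q) p = \sum_(j <- r) vaction X (F j) p.
Proof.
move=> oV cp Vp sF.
rewrite (vactionE X oV cp Vp (smooth_near_sum oV r sF)).
under [RHS]eq_bigr => j _ do rewrite (vactionE X oV cp Vp (sF j)).
rewrite exchange_big; apply: eq_bigr => k _.
by rewrite (pderiv_sum oV cp Vp r k sF) mulr_sumr.
Qed.

(** The product rule separates the first-order part from the second-order part; the latter is
    symmetric in [X] and [Y] and cancels in the commutator. *)
Lemma vaction_twice c V p X Y f : open V -> dom c p -> V p ->
  smooth_vfield Y -> smooth_near c V f ->
  vaction X (vaction Y f) p =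
    \sum_k vaction X (vaction Y (coord c k)) p * pderiv c k f p +
    \sum_i \sum_j vaction X (coord c i) p * vaction Y (coord c j) p *
                  pderiv c i (pderiv c j f) p.
Proof.
move=> oV cp Vp sY sf.
have sYk k : smooth_near c V (vaction Y (coord c k)) by exact: smooth_in_near.
have sfk k := smooth_near_pderiv oV k sf.
pose G q := \sum_j (vaction Y (coord c j) * pderiv c j f) q.
have E q : dom c q -> V q -> vaction Y f q = G q.
  by move=> cq Vq; exact: vactionE oV cq Vq sf.
rewrite (eq_vaction X oV cp Vp (smooth_near_vaction oV sY sf) E).
rewrite (vaction_sum X _ oV cp Vp (fun j => smooth_nearM oV (sYk j) (sfk j))).
under eq_bigr => j _ do
  rewrite (vactionM X oV cp Vp (sYk j) (sfk j)) addrC mulrC.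
rewrite big_split /=; congr (_ + _); rewrite exchange_big /=.
apply: eq_bigr => j _; rewrite (vactionE X oV cp Vp (sfk j)) mulr_sumr.
by apply: eq_bigr => i _; rewrite mulrA [_ * vaction X _ _]mulrC.
Qed.

Lemma vaction_commutator c V p X Y f : open V -> dom c p -> V p ->
  smooth_vfield X -> smooth_vfield Y -> smooth_near c V f ->
  vaction X (vaction Y f) p - vaction Y (vaction X f) p =
  \sum_k (vaction X (vaction Y (coord c k)) p -
          vaction Y (vaction X (coord c k)) p) * pderiv c k f p.
Proof.
move=> oV cp Vp sX sY sf.
rewrite (vaction_twice X oV cp Vp sY sf) (vaction_twice Y oV cp Vp sX sf).
rewrite opprD addrACA -sumrB.
under eq_bigr => k _ do rewrite -mulrBl.
(* With the summation indices of one second-order sum exchanged, [pderivC] identifies it with the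
   other. *)
rewrite [X in _ + (X - _)]exchange_big /=.
rewrite [X in _ + X](_ : _ = 0) ?addr0 //; apply/eqP; rewrite subr_eq0; apply/eqP.
apply: eq_bigr => i _; apply: eq_bigr => j _.
by rewrite (pderivC oV cp Vp j i sf) [vaction X _ _ * _]mulrC.
Qed.

(** [vaction_commutator] serves twice: in [c] for [f], and in [chart_at p], where the bracket is
    defined, for the coordinates of [c]. *)
Lemma vaction_vbracket c V p X Y f : open V -> dom c p -> V p ->
  smooth_vfield X -> smooth_vfield Y -> smooth_near c V f ->
  vaction (vbracket X Y) f p =
  vaction X (vaction Y f) p - vaction Y (vaction X f) p.
Proof.
move=> oV cp Vp sX sY sf.
rewrite (vactionE _ oV cp Vp sf) (vaction_commutator oV cp Vp sX sY sf).
apply: eq_bigr => k _; congr (_ * _).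
rewrite (vaction_commutator (dom_open c) (mem_chart_at p) cp sX sY
  (@smooth_near_coord _ _ M (chart_at p) c k)).
by rewrite [LHS]/vaction; apply: eq_bigr => i _; rewrite mxE.
Qed.

Lemma smooth_vfield_vbracket X Y :
  smooth_vfield X -> smooth_vfield Y -> smooth_vfield (vbracket X Y).
Proof.
move=> sX sY c j.
have sc : smooth_near c setT (coord c j).
  by apply/smooth_near_setT; exact: smooth_in_coord.
have oT : open (setT : set M) := openT.
have E q : dom c q -> setT q ->
    (vaction X (vaction Y (coord c j)) - vaction Y (vaction X (coord c j))) q =
    vaction (vbracket X Y) (coord c j) q.
  by move=> cq Tq; rewrite (vaction_vbracket oT cq Tq sX sY sc).
have sXY := smooth_near_vaction oT sX (smooth_near_vaction oT sY sc).
have sYX := smooth_near_vaction oT sY (smooth_near_vaction oT sX sc).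
exact/smooth_near_setT/(eq_smooth_near oT E (smooth_nearB oT sXY sYX)).
Qed.

Lemma vbracket_alt X : vbracket X X = 0.
Proof. by apply/funext => p; apply/rowP => j; rewrite !mxE subrr. Qed.

Lemma vbracketN X Y : vbracket X Y = - vbracket Y X.
Proof. by apply/funext => p; apply/rowP => j; rewrite !mxE opprB. Qed.

Lemma vbracket_linl X Y Z (k : R) :
  smooth_vfield X -> smooth_vfield Y -> smooth_vfield Z ->
  vbracket (k *: X + Y) Z = k *: vbracket X Z + vbracket Y Z.
Proof.
move=> sX sY sZ; apply/funext => p; apply/rowP => j.
have oT : open (setT : set M) := openT.
have cp := mem_chart_at p; have Tp : [set: M] p by [].
set x := coord (chart_at p) j.
have sx : smooth_near (chart_at p) setT x.
  by apply/smooth_near_setT; exact: smooth_in_coord.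
have sXx := smooth_near_vaction oT sX sx.
have sYx := smooth_near_vaction oT sY sx.
have -> : vbracket (k *: X + Y) Z p 0 j =
    vaction (k *: X + Y) (vaction Z x) p - vaction Z (vaction (k *: X + Y) x) p.
  by rewrite mxE.
have -> : (k *: vbracket X Z + vbracket Y Z) p 0 j =
    k * (vaction X (vaction Z x) p - vaction Z (vaction X x) p) +
    (vaction Y (vaction Z x) p - vaction Z (vaction Y x) p).
  by rewrite !mxE.
rewrite !vaction_lin.
(* The scalar becomes a constant function, so that the product rule applies to it. *)
have -> : k *: vaction X x + vaction Y x = cst k * vaction X x + vaction Y x by [].
have sk := smooth_nearM oT (smooth_near_cst k) sXx.
rewrite (vactionD Z oT cp Tp sk sYx).
rewrite (vactionM Z oT cp Tp (smooth_near_cst k) sXx).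
have -> : vaction Z (cst k) p = 0.
  by rewrite /vaction big1 // => i _; rewrite pderiv_cst mulr0.
rewrite mulr0 addr0 -[(cst k) p]/k.
rewrite -[(k *: _ + _) p]/(k * vaction X (vaction Z x) p + vaction Y (vaction Z x) p).
by rewrite opprD addrACA mulrBr.
Qed.

(** By [J], each component of a double bracket is a sum of four triple actions on a coordinate
    function; the twelve terms cancel in pairs. *)
Lemma vbracket_jacobi X Y Z :
  smooth_vfield X -> smooth_vfield Y -> smooth_vfield Z ->
  vbracket X (vbracket Y Z) + vbracket Y (vbracket Z X) +
  vbracket Z (vbracket X Y) = 0.
Proof.
move=> sX sY sZ; apply/funext => p; apply/rowP => j.
have oT : open (setT : set M) := openT.
have cp := mem_chart_at p; have Tp : [set: M] p by [].
set x := coord (chart_at p) j.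
have sx : smooth_near (chart_at p) setT x.
  by apply/smooth_near_setT; exact: smooth_in_coord.
have s1 A := fun sA => @smooth_near_vaction _ _ A _ oT sA sx.
have s2 A B := fun sA sB => @smooth_near_vaction _ _ A _ oT sA (s1 B sB).
have J A B C : smooth_vfield A -> smooth_vfield B -> smooth_vfield C ->
    vbracket A (vbracket B C) p 0 j =
    vaction A (vaction B (vaction C x)) p - vaction A (vaction C (vaction B x)) p -
    (vaction B (vaction C (vaction A x)) p - vaction C (vaction B (vaction A x)) p).
  move=> sA sB sC; rewrite mxE; congr (_ - _).
    rewrite -(vactionB A oT cp Tp (s2 _ _ sB sC) (s2 _ _ sC sB)).
    have sBC := smooth_vfield_vbracket sB sC.
    apply: (eq_vaction A oT cp Tp (s1 _ sBC)) => q cq Tq.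
    exact: vaction_vbracket oT cq Tq sB sC sx.
  exact: vaction_vbracket oT cp Tp sB sC (s1 _ sA).
have mxD (u v t : 'rV[R]_m) : (u + v + t) 0 j = u 0 j + v 0 j + t 0 j.
  by rewrite !mxE.
apply: etrans (mxD _ _ _) _.
rewrite (J X Y Z sX sY sZ) (J Y Z X sY sZ sX) (J Z X Y sZ sX sY) [RHS]mxE.
move: (vaction X (vaction Y (vaction Z x)) p) (vaction X (vaction Z (vaction Y x)) p)
  (vaction Y (vaction Z (vaction X x)) p) (vaction Y (vaction X (vaction Z x)) p)
  (vaction Z (vaction X (vaction Y x)) p) (vaction Z (vaction Y (vaction X x)) p).
by move=> a1 a2 a3 a4 a5 a6; ring.
Qed.

End vector_fields.

(** * Forms and contraction *)

Section forms.
Variables (R : realType) (m : nat) (M : smoothManifold R m).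
Implicit Types (c d : chart_idx M) (p q : M) (f g H : M -> R) (V : set M).
Implicit Types (X Y : M -> 'rV[R]_m) (a : M -> 'cV[R]_m).
Local Notation dom c := (chart_dom (charts c)).
Local Notation coord c := (chart_coord (charts c)).

(** [ext_d0] is written in [chart_at p]; [pderiv_change] carries it to every chart around [p]. *)
Lemma form1_comp_ext_d0 H c i p : smooth_fun H -> dom c p ->
  form1_comp (ext_d0 H) c i p = pderiv c i H p.
Proof.
move=> sH cp; rewrite /form1_comp mxE.
have sHd := smooth_in_near (V := setT) (sH (chart_at p)).
rewrite (pderiv_change openT cp I i (mem_chart_at p) sHd).
by apply: eq_bigr => j _; rewrite !mxE.
Qed.

(** The identity d d = 0, by symmetry of second derivatives. *)
Lemma exact_closed_form1 a : exact_form1 a -> closed_form1 a.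
Proof.
move=> [H sH ->].
have E c i q : dom c q -> setT q -> pderiv c i H q = form1_comp (ext_d0 H) c i q.
  by move=> cq _; rewrite form1_comp_ext_d0.
have sHc c : smooth_near c setT H by exact: smooth_in_near.
split=> [c i|].
  apply/smooth_near_setT.
  have sp := smooth_near_pderiv openT i (sHc c).
  exact (eq_smooth_near openT (E c i) sp).
apply/funext => p; apply/matrixP => i j; rewrite !mxE; set c := chart_at p.
have cp : dom c p by exact: mem_chart_at.
rewrite -(eq_pderiv openT cp I i (E c j)) -(eq_pderiv openT cp I j (E c i)).
by rewrite (pderivC openT cp I i j (sHc c)) subrr.
Qed.

Lemma form1_comp_chart_at a i p : form1_comp a (chart_at p) i p = a p i 0.
Proof. by rewrite /form1_comp coord_vec_chart_at -rowE mxE. Qed.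

Lemma form2_eval_sumr (w : M -> 'M[R]_m) p (I J : finType) (s : I -> R)
    (u : I -> 'rV[R]_m) (t : J -> R) (v : J -> 'rV[R]_m) :
  form2_eval w p (\sum_i s i *: u i) (\sum_j t j *: v j) =
  \sum_i \sum_j s i * t j * form2_eval w p (u i) (v j).
Proof.
rewrite /form2_eval !mulmx_suml summxE; apply: eq_bigr => i _.
rewrite linear_sum mulmx_sumr summxE; apply: eq_bigr => j _.
by rewrite linearZ /= -!scalemxAl -scalemxAr !mxE -mulrA.
Qed.

(* The derivatives of [x], [y] and of the form [w] along the i-th coordinate are
   [dx i], [dy i] and [dw i]; [cx] and [cy] express the closedness of [i_X w] and
   [i_Y w]. *)
Lemma contraction_bracket_identity (x y : 'I_m -> R) (w dx dy : 'I_m -> 'I_m -> R)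
    (dw : 'I_m -> 'I_m -> 'I_m -> R) (l : 'I_m) :
  (forall i j, w i j = - w j i) -> (forall k i j, dw k i j = - dw k j i) ->
  (forall i j k, dw i j k + dw j k i + dw k i j = 0) ->
  (forall i k, \sum_j (dx i j * w j k + x j * dw i j k) =
               \sum_j (dx k j * w j i + x j * dw k j i)) ->
  (forall i k, \sum_j (dy i j * w j k + y j * dw i j k) =
               \sum_j (dy k j * w j i + y j * dw k j i)) ->
  - \sum_k (\sum_i x i * dy i k - \sum_i y i * dx i k) * w k l =
  \sum_i \sum_j (dx l i * y j * w i j + x i * dy l j * w i j +
                 x i * y j * dw l i j).
Proof.
move=> wN dwN dw0 cx cy.
(* [E1] contracts the closedness of [i_Y w] with [x]; [E2] contracts that of [i_X w] with [y]. *)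
have E1 : \sum_i x i * \sum_j (dy i j * w j l + y j * dw i j l) =
          \sum_i x i * \sum_j (dy l j * w j i + y j * dw l j i).
  by apply: eq_bigr => i _; rewrite cy.
have E2 : \sum_j y j * \sum_i (dx j i * w i l + x i * dw j i l) =
          \sum_j y j * \sum_i (dx l i * w i j + x i * dw l i j).
  by apply: eq_bigr => i _; rewrite cx.
have dist (F : 'I_m -> 'I_m -> R) (s : 'I_m -> R) :
  \sum_i s i * \sum_j F i j = \sum_i \sum_j s i * F i j.
  by apply: eq_bigr => i _; rewrite mulr_sumr.
rewrite !dist in E1 E2; rewrite [LHS]exchange_big [RHS]exchange_big /= in E2.
have -> : - \sum_k (\sum_i x i * dy i k - \sum_i y i * dx i k) * w k l =
    \sum_i \sum_j (y j * dx j i * w i l) - \sum_i \sum_j (x i * dy i j * w j l).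
  rewrite [X in _ - X]exchange_big -sumrB -sumrN; apply: eq_bigr => k _ /=.
  by rewrite mulrBl opprB !mulr_suml.
(* One side of [E1] and one of [E2] are added to both sides and then traded on the left for their
   other sides; the double sums now agree term by term. *)
apply: (addIr (\sum_i \sum_j x i * (dy l j * w j i + y j * dw l j i) +
  \sum_i \sum_j y j * (dx j i * w i l + x i * dw j i l))).
rewrite -{1}E1 {1}E2 -!sumrB -!big_split; apply: eq_bigr => i _.
rewrite -!sumrB -!big_split; apply: eq_bigr => j _ /=.
(* Closedness of [w] removes one cyclic term; skew-symmetry brings the rest to a common form. *)
have -> : dw i j l = - dw j l i - dw l i j.
  by apply/eqP; rewrite -opprD -addr_eq0 addrA dw0.
rewrite (wN j i) (dwN l j i) (dwN j i l); ring.
Qed.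

(** * Contraction of vector fields with the symplectic form *)

Section symplectic_form.
Variable w : symplecticForm M.
Local Notation E := (EL_contract w).
Local Notation W := (form2_comp w).

Lemma form2_eval_skew p u v : form2_eval w p u v = - form2_eval w p v u.
Proof.
have := sform_alternating w p (u + v); have := sform_alternating w p u.
have := sform_alternating w p v; rewrite /form2_eval linearD /= !mulmxDl !mulmxDr.
rewrite !mxE => -> ->; rewrite add0r addr0 => /eqP.
by rewrite addr_eq0 => /eqP.
Qed.

Lemma form1_comp_EL_contract X c i p :
  form1_comp (E X) c i p = - form2_eval w p (X p) (coord_vec c i p).
Proof.
rewrite /form1_comp /EL_contract /form2_eval mulmxN mxE; congr (- _).
by rewrite -{1}[coord_vec c i p]trmxK -trmx_mul mxE.
Qed.

Lemma form2_eval_comp X Y c p : dom c p -> form2_eval w p (X p) (Y p) =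
  \sum_i \sum_j vaction X (coord c i) p * vaction Y (coord c j) p * W c i j p.
Proof.
move=> cp; rewrite (coord_decomposition X cp) (coord_decomposition Y cp).
exact: form2_eval_sumr.
Qed.

Lemma form1_comp_EL_contractE X c i p : dom c p ->
  form1_comp (E X) c i p = - \sum_j vaction X (coord c j) p * W c j i p.
Proof.
move=> cp; rewrite form1_comp_EL_contract (coord_decomposition X cp).
rewrite /form2_eval !mulmx_suml summxE; congr (- _); apply: eq_bigr => j _.
by rewrite -!scalemxAl mxE.
Qed.

Lemma smooth_near_component X c j :
  smooth_vfield X -> smooth_near c setT (vaction X (coord c j)).
Proof. by move=> sX; apply: smooth_in_near; exact: sX. Qed.

Lemma smooth_near_form2_comp c i j : smooth_near c setT (W c i j).
Proof. by apply: smooth_in_near; exact: sform_smooth. Qed.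
Let sW := smooth_near_form2_comp.

(** Puts the closedness of [E X] into the shape required by [contraction_bracket_identity]. *)
Lemma pderiv_EL_contract X c p i k : smooth_vfield X -> dom c p ->
  pderiv c i (form1_comp (E X) c k) p =
  - \sum_j (pderiv c i (vaction X (coord c j)) p * W c j k p +
            vaction X (coord c j) p * pderiv c i (W c j k) p).
Proof.
move=> sX cp; have sXc j := @smooth_near_component X c j sX.
pose G q := \sum_j (vaction X (coord c j) * W c j k) q.
have sXW j := smooth_nearM openT (sXc j) (@sW c j k).
have H q : dom c q -> setT q -> form1_comp (E X) c k q = (- G) q.
  by move=> cq _; rewrite form1_comp_EL_contractE.
rewrite (eq_pderiv openT cp I i H).
have sG : smooth_near c setT G := smooth_near_sum openT _ sXW.
rewrite (pderivN cp I i sG) (pderiv_sum openT cp I _ i sXW); congr (- _).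
apply: eq_bigr => j _.
by rewrite (pderivM cp I i (sXc j) (@sW c j k)) addrC [W c j k p * _]mulrC.
Qed.

Section bracket.
Variables (X Y : M -> 'rV[R]_m).
Hypotheses (sX : smooth_vfield X) (sY : smooth_vfield Y).

Let sXc c j := @smooth_near_component X c j sX.
Let sYc c j := @smooth_near_component Y c j sY.

(** The Hamiltonian of [vbracket X Y] when [X] and [Y] are symplectic. *)
Let FXY q := form2_eval w q (X q) (Y q).

Let FXY_comp c q : dom c q -> setT q ->
  \sum_i (fun q' => \sum_j
    (vaction X (coord c i) * vaction Y (coord c j) * W c i j) q') q = FXY q.
Proof. by move=> cq _; rewrite /FXY (form2_eval_comp X Y cq). Qed.

Let sXYW c i j :=
  smooth_nearM openT (smooth_nearM openT (@sXc c i) (@sYc c j)) (@sW c i j).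
Let sXYWi c i := smooth_near_sum openT (index_enum _) (@sXYW c i).

Lemma smooth_fun_form2_eval : smooth_fun FXY.
Proof.
move=> c; apply/smooth_near_setT.
have sS := smooth_near_sum openT (index_enum _) (@sXYWi c).
exact (eq_smooth_near openT (@FXY_comp c) sS).
Qed.

Lemma pderiv_form2_eval c p l : dom c p -> pderiv c l FXY p =
  \sum_i \sum_j
    (pderiv c l (vaction X (coord c i)) p * vaction Y (coord c j) p * W c i j p +
     vaction X (coord c i) p * pderiv c l (vaction Y (coord c j)) p * W c i j p +
     vaction X (coord c i) p * vaction Y (coord c j) p * pderiv c l (W c i j) p).
Proof.
move=> cp; rewrite -(eq_pderiv openT cp I l (@FXY_comp c)).
rewrite (pderiv_sum openT cp I _ l (@sXYWi c)); apply: eq_bigr => i _.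
rewrite (pderiv_sum openT cp I _ l (@sXYW c i)); apply: eq_bigr => j _.
rewrite (pderivM cp I l (smooth_nearM openT (@sXc c i) (@sYc c j)) (@sW c i j)).
rewrite (pderivM cp I l (@sXc c i) (@sYc c j)).
rewrite -[(vaction X _ * vaction Y _) p]/(vaction X _ p * vaction Y _ p).
move: (vaction X _ p) (vaction Y _ p) (W _ _ _ p) (pderiv _ _ (vaction X _) p)
  (pderiv _ _ (vaction Y _) p) (pderiv _ _ (W _ _ _) p) => a1 a2 a3 a4 a5 a6.
ring.
Qed.

(** In Cartan's calculus, [i_[X,Y] w = L_X i_Y w - i_Y L_X w = - d (w (X, Y))]. Here the components
    in [chart_at p] are compared by [contraction_bracket_identity]. *)
Lemma EL_contract_vbracket : closed_form1 (E X) -> closed_form1 (E Y) ->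
  E (vbracket X Y) = ext_d0 FXY.
Proof.
move=> [_ cX] [_ cY]; apply/funext => p; apply/colP => l.
set c := chart_at p; have cp : dom c p := mem_chart_at p.
have cl Z : smooth_vfield Z -> ext_d1 (E Z) = 0 -> forall i k,
    pderiv c i (form1_comp (E Z) c k) p = pderiv c k (form1_comp (E Z) c i) p.
  move=> sZ cZ i k; have /matrixP/(_ i k) := congr1 (@^~ p) cZ.
  by rewrite !mxE => /eqP; rewrite subr_eq0 => /eqP.
rewrite -form1_comp_chart_at (form1_comp_EL_contractE _ _ cp) mxE.
rewrite (pderiv_form2_eval l cp).
rewrite -(@contraction_bracket_identity _ _ (fun i j => W c i j p)
  (fun i j => pderiv c i (vaction X (coord c j)) p)
  (fun i j => pderiv c i (vaction Y (coord c j)) p)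
  (fun k i j => pderiv c k (W c i j) p)).
- congr (- _); apply: eq_bigr => k _; congr (_ * _).
  have sc : smooth_near c setT (coord c k).
    by apply/smooth_near_setT; exact: smooth_in_coord.
  rewrite (vaction_vbracket openT cp I sX sY sc).
  by rewrite (vactionE X openT cp I (@sYc c k)) (vactionE Y openT cp I (@sXc c k)).
- by move=> i j; exact: form2_eval_skew.
- move=> k i j; rewrite -(pderivN cp I k (@sW c j i)); apply: (eq_pderiv openT cp I).
  by move=> q _ _; exact: form2_eval_skew.
- exact: sform_closed.
- move=> i k; have := cl X sX cX i k.
  rewrite (pderiv_EL_contract i k sX cp) (pderiv_EL_contract k i sX cp).
  by move=> /oppr_inj.
- move=> i k; have := cl Y sY cY i k.
  rewrite (pderiv_EL_contract i k sY cp) (pderiv_EL_contract k i sY cp).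
  by move=> /oppr_inj.
Qed.

End bracket.

Lemma sform_unitmx p : w p \in unitmx.
Proof.
rewrite -row_free_unit; apply/inj_row_free => u uw.
apply: (@sform_nondegenerate _ _ _ w p) => v; by rewrite /form2_eval uw mul0mx mxE.
Qed.

(** Nondegeneracy solves the equation pointwise. Smoothness follows in each chart by solving it
    again in the coordinate frame, where the matrix of [w] and its inverse are smooth. *)
Lemma EL_contract_surj a : smooth_form1 a ->
  exists2 X, smooth_vfield X & E X = a.
Proof.
move=> sa; pose X q := - (a q)^T *m invmx (w q).
have EX : E X = a.
  apply/funext => q; rewrite /EL_contract /X -mulmxA mulVmx ?sform_unitmx //.
  by rewrite mulmx1 linearN /= trmxK opprK.
exists X; last exact EX.
move=> c j; apply/smooth_near_setT.
(* The matrix of [w] in the frame of [c]. The matrix [w q] itself refers to [chart_at q], which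
   varies with [q]. *)
pose A q := \matrix_(i, k) W c i k q.
have uA q : dom c q -> setT q -> A q \in unitmx.
  move=> cq _; set d := chart_at q.
  pose J := \matrix_i coord_vec c i q.
  pose K := \matrix_(k, j) pderiv d k (coord c j) q.
  (* The chain rule between [chart_at q] and [c] makes [J] invertible, and [A q] is congruent to
     [w q] through [J]. *)
  have KJ : K *m J = 1%:M.
    apply/matrixP => k l; rewrite !mxE -(pderiv_coord k l (mem_chart_at q)).
    have sdl := @smooth_near_coord _ _ M c d l.
    rewrite (pderiv_change (dom_open d) (mem_chart_at q) (mem_chart_at q) k cq sdl).
    by apply: eq_bigr => i _; rewrite !mxE.
  have [_ uJ] := mulmx1_unit KJ.
  have -> : A q = J *m w q *m J^T.
    have rJ i : coord_vec c i q = row i J by rewrite rowK.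
    apply/matrixP => i k; rewrite mxE /form2_comp /form2_eval !rJ -row_mul tr_row.
    by rewrite mxE [RHS]mxE; apply: eq_bigr => l _; congr (_ * _); rewrite mxE.
  by rewrite !unitmx_mul unitmx_tr uJ sform_unitmx.
have sAik i k : smooth_near c setT (fun q => A q i k).
  have Aik q : dom c q -> setT q -> W c i k q = A q i k by rewrite mxE.
  exact (eq_smooth_near openT Aik (@sW c i k)).
have sAV i := smooth_near_invmx openT i j sAik uA.
have sac i : smooth_near c setT (form1_comp a c i).
  by apply: smooth_in_near; exact: sa.
have sac' i := smooth_nearM openT (smooth_nearN openT (sac i)) (sAV i).
have sS := smooth_near_sum openT (index_enum _) sac'.
have XE q : dom c q -> setT q ->
    \sum_i (- form1_comp a c i * (fun q => invmx (A q) i j)) q =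
    vaction X (coord c j) q.
  move=> cq Tq.
  (* The equation [E X = a] in the frame of [c]; inverting [A q] gives the components of [X]. *)
  have E1 : \row_i vaction X (coord c i) q *m A q = - \row_i form1_comp a c i q.
    apply/rowP => i; rewrite !mxE -EX (form1_comp_EL_contractE _ _ cq) opprK.
    by apply: eq_bigr => k _; rewrite !mxE.
  have : \row_i vaction X (coord c i) q =
         - \row_i form1_comp a c i q *m invmx (A q).
    by rewrite -E1 mulmxK // uA.
  move=> /rowP/(_ j); rewrite [LHS]mxE => ->; rewrite mxE.
  by apply: eq_bigr => i _; rewrite !mxE.
exact (eq_smooth_near openT XE sS).
Qed.

End symplectic_form.
End forms.

(** * Subquotients and the theorem *)

Section subquotient_theory.
Variables (R : pzRingType) (V : lmodType R) (A B : submodClosed V).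

Lemma subq_class_eq (u v : subspace_of A) :
  (subq_class B u = subq_class B v) <-> (val u - val v \in B).
Proof.
have E : (subq_class B u == subq_class B v) = (val u - val v \in B).
  by rewrite /subq_class -[LHS](Quotient.idealrBE (submod_zmod (trace_in A B))).
by rewrite -E; split=> [->|/eqP].
Qed.

Lemma subq_classK (x : subquotient A B) : subq_class B (repr x) = x.
Proof. exact: reprK. Qed.

Lemma subq_class_linear k (u v : subspace_of A) :
  subq_class B (k *: u + v) = k *: subq_class B u + subq_class B v.
Proof. by rewrite /subq_class pi_quotD -pi_quot_scale. Qed.

End subquotient_theory.

(** * Isomorphisms of subquotients induced by linear maps *)

Section subquotient_map.
Variables (R : pzRingType) (V V' : lmodType R).
Variables (A B : submodClosed V) (A' B' : submodClosed V') (phi : V -> V').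
Hypotheses (phi_lin : linear phi) (phiA : forall u, u \in A -> phi u \in A').
Hypothesis phiB : forall u, u \in A -> (phi u \in B') = (u \in B).
Hypothesis phi_surj : forall v, v \in A' -> exists2 u, u \in A & phi u = v.

Let phiD u v : phi (u - v) = phi u - phi v.
Proof. by rewrite addrC -scaleN1r phi_lin scaleN1r addrC. Qed.

Let phi_sub (u : subspace_of A) : subspace_of A' :=
  SubspaceOf (phiA (subspace_valP u)).

(** Right to left, the induced map is well defined; left to right, it is injective. *)
Let phi_class (u v : subspace_of A) :
  (subq_class B' (phi_sub u) = subq_class B' (phi_sub v)) <->
  (subq_class B u = subq_class B v).
Proof.
have uvA : val u - val v \in A := subspace_valP (u - v).
split=> /subq_class_eq e; apply/subq_class_eq; move: e => /=.
  by rewrite -phiD phiB.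
by rewrite -phiD phiB.
Qed.

Definition subq_map (x : subquotient A B) : subquotient A' B' :=
  subq_class B' (phi_sub (repr x)).

Let subq_map_class u : subq_map (subq_class B u) = subq_class B' (phi_sub u).
Proof. by apply/phi_class; rewrite subq_classK. Qed.

Fact subq_map_linear : linear subq_map.
Proof.
move=> k x y; rewrite -[x]subq_classK -[y]subq_classK -subq_class_linear.
rewrite !subq_map_class -subq_class_linear; congr (subq_class B' _).
by apply: val_inj; rewrite /= phi_lin.
Qed.
HB.instance Definition _ :=
  GRing.isLinear.Build R (subquotient A B) (subquotient A' B') _ subq_map
    subq_map_linear.

Lemma subq_map_inj : injective subq_map.
Proof.
move=> x y; rewrite -[x]subq_classK -[y]subq_classK !subq_map_class.
by move/phi_class.
Qed.

Lemma subq_map_surj y : exists x, subq_map x = y.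
Proof.
have [u uA e] := phi_surj (subspace_valP (repr y)).
exists (subq_class B (SubspaceOf uA)); rewrite subq_map_class -[y]subq_classK.
by congr (subq_class B' _); apply: val_inj.
Qed.

Lemma subquotient_iso :
  exists f : {linear subquotient A B -> subquotient A' B'}, bijective f.
Proof.
exists subq_map; have [g gK] := choice subq_map_surj.
by exists g => // x; apply: subq_map_inj; rewrite gK.
Qed.

End subquotient_map.

(** * The Lie algebra of symplectic fields and the cohomology groups *)

Section symplectic_fields.
Variables (R : realType) (m : nat) (M : smoothManifold R m).
Variable w : symplecticForm M.
Implicit Types X Y : M -> 'rV[R]_m.

Lemma symplectic_fieldsP X : reflect
  (smooth_vfield X /\ closed_form1 (EL_contract w X)) (X \in symplectic_fields w).
Proof. exact: asboolP. Qed.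

Lemma hamiltonian_fieldsP X : reflect
  (smooth_vfield X /\ exact_form1 (EL_contract w X)) (X \in hamiltonian_fields w).
Proof. exact: asboolP. Qed.

Lemma hamiltonian_sub_symplectic :
  {subset hamiltonian_fields w <= symplectic_fields w}.
Proof.
move=> X /hamiltonian_fieldsP[sX /exact_closed_form1 cX].
exact/symplectic_fieldsP.
Qed.

(** The source of three facts: symplectic fields are closed under the bracket, Hamiltonian fields
    form an ideal, and the quotient is Abelian. *)
Lemma vbracket_hamiltonian X Y : X \in symplectic_fields w ->
  Y \in symplectic_fields w -> vbracket X Y \in hamiltonian_fields w.
Proof.
move=> /symplectic_fieldsP[sX cX] /symplectic_fieldsP[sY cY].
apply/hamiltonian_fieldsP; split; first exact: smooth_vfield_vbracket.
exists (fun q => form2_eval w q (X q) (Y q)).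
  exact: smooth_fun_form2_eval.
exact: EL_contract_vbracket.
Qed.

Definition symplectic_bracket (X Y : subspace_of (symplectic_fields w)) :
    subspace_of (symplectic_fields w) :=
  SubspaceOf (hamiltonian_sub_symplectic
    (vbracket_hamiltonian (subspace_valP X) (subspace_valP Y))).

Let smooth_val (X : subspace_of (symplectic_fields w)) :
  smooth_vfield (subspace_val X).
Proof. by have /symplectic_fieldsP[] := subspace_valP X. Qed.

Lemma symplectic_lie_bracket : lie_bracket symplectic_bracket.
Proof.
split.
- move=> Z k X Y; apply: val_inj.
  exact: vbracket_linl (smooth_val X) (smooth_val Y) (smooth_val Z).
- move=> Z k X Y; apply: val_inj.
  (* Linearity on the right follows from linearity on the left by antisymmetry. *)
  apply: etrans (vbracketN _ _) _.
  rewrite [vbracket _ _](vbracket_linl k (smooth_val X) (smooth_val Y) (smooth_val Z)).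
  by rewrite opprD -scalerN -!vbracketN.
- by move=> X; apply: val_inj; exact: vbracket_alt.
- move=> X Y Z; apply: val_inj.
  exact: vbracket_jacobi (smooth_val X) (smooth_val Y) (smooth_val Z).
Qed.

Lemma symplectic_bracket_ideal :
  lie_ideal symplectic_bracket
    (trace_in (symplectic_fields w) (hamiltonian_fields w)).
Proof.
by move=> X Y _; exact: vbracket_hamiltonian (subspace_valP X) (subspace_valP Y).
Qed.

Lemma subq_class_symplectic_bracket (X Y : subspace_of (symplectic_fields w)) :
  subq_class (hamiltonian_fields w) (symplectic_bracket X Y) = 0.
Proof.
set u := symplectic_bracket X Y.
have -> : subq_class (hamiltonian_fields w) u = subq_class (hamiltonian_fields w) 0.
  apply/subq_class_eq; rewrite subr0.
  exact: vbracket_hamiltonian (subspace_valP X) (subspace_valP Y).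
have -> : (0 : subspace_of (symplectic_fields w)) = -1 *: u + u.
  by rewrite scaleN1r addNr.
by rewrite subq_class_linear scaleN1r addNr.
Qed.

Lemma closed_formsP (a : M -> 'cV[R]_m) :
  reflect (closed_form1 a) (a \in @closed_forms R m M).
Proof. exact: asboolP. Qed.

Lemma EL_contract_span X : smooth_vfield X -> EL_contract w X \in EL_span w.
Proof.
move=> sX; apply/asboolP; exists [:: EL_contract w X]; last by rewrite big_seq1.
(* An Euler-Lagrange form with [H = 0]. *)
move=> b; rewrite mem_seq1 => /eqP ->; exists X, 0; split=> //.
  exact: smooth_fun0.
by rewrite ext_d0_0 subr0.
Qed.

Let EL_linear : linear (EL_contract w).
Proof. by move=> k X Y; exact: EL_contract_lin. Qed.

Let EL_exact X : X \in symplectic_fields w ->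
  (EL_contract w X \in @exact_forms R m M) = (X \in hamiltonian_fields w).
Proof.
move=> /symplectic_fieldsP[sX _]; apply/idP/idP.
  by move=> /asboolP eX; apply/hamiltonian_fieldsP.
by move=> /hamiltonian_fieldsP[_ eX]; apply/asboolP.
Qed.

Let EL_surj a : a \in @closed_forms R m M ->
  exists2 X, X \in symplectic_fields w & EL_contract w X = a.
Proof.
move=> /closed_formsP ca; have [X sX EX] := EL_contract_surj w ca.1.
by exists X => //; apply/symplectic_fieldsP; rewrite EX.
Qed.

Lemma symplectic_quotient_deRham :
  exists f : {linear subquotient (symplectic_fields w) (hamiltonian_fields w) ->
                     deRham1 M}, bijective f.
Proof.
apply: (subquotient_iso EL_linear) EL_exact EL_surj.
by move=> X /symplectic_fieldsP[_ cX]; exact/closed_formsP.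
Qed.

(** Every [EL_contract w X] with [X] smooth lies in [EL_span w], so the map used for [deRham1] also
    matches the subspaces cut down to [EL_span w]. *)
Lemma symplectic_quotient_EL :
  exists f : {linear subquotient (symplectic_fields w) (hamiltonian_fields w) ->
                     EL_cohomology w}, bijective f.
Proof.
apply: (subquotient_iso EL_linear) => [X|X XS|a /andP[_ /EL_surj]] //.
  move=> /symplectic_fieldsP[sX cX]; apply/andP; split.
    exact: EL_contract_span.
  exact/closed_formsP.
rewrite -EL_exact //; apply/andP/idP => [[]//|eX]; split=> //.
by have /symplectic_fieldsP[sX _] := XS; exact: EL_contract_span.
Qed.

End symplectic_fields.

Theorem theorem2 (R : realType) (m : nat) (M : smoothManifold R m)
    (w : symplecticForm M) :
  let XS := subspace_of (symplectic_fields w) in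
  let Q := subquotient (symplectic_fields w) (hamiltonian_fields w) in
  exists br : XS -> XS -> XS,
    [/\ forall X Y : XS, val (br X Y) = vbracket (val X) (val Y),
        lie_bracket br,
        {subset hamiltonian_fields w <= symplectic_fields w},
        lie_ideal br (trace_in (symplectic_fields w) (hamiltonian_fields w)) &
        exists brQ : Q -> Q -> Q,
          [/\ forall X Y : XS, brQ (subq_class _ X) (subq_class _ Y) =
                               subq_class _ (br X Y),
              lie_bracket brQ,
              forall x y : Q, brQ x y = 0,
              exists f : {linear Q -> deRham1 M}, bijective f &
              exists g : {linear Q -> EL_cohomology w}, bijective g]].
Proof.
exists (@symplectic_bracket R m M w); split.
- by [].
- exact: symplectic_lie_bracket.
- exact: hamiltonian_sub_symplectic.
- exact: symplectic_bracket_ideal.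
(* All brackets vanish in the quotient, so the induced bracket is zero. *)
exists (fun _ _ => 0); split.
- by move=> X Y; rewrite subq_class_symplectic_bracket.
- by split=> [z k x y|z k x y|//|x y z]; rewrite ?scaler0 !addr0.
- by [].
- exact: symplectic_quotient_deRham.
- exact: symplectic_quotient_EL.
Qed.
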